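(* Let $f_0\in\mathcal{B}$ be the unique invariant probability density of $\mathcal{L}_0$ and, for $\delta>0$ small, let $f_\delta\in\mathcal{B}$ be the unique invariant probability density of $\mathcal{L}_\delta$ ($\int f_\delta=1$, $\mathcal{L}_\delta f_\delta=f_\delta$). Then $\dot{\mathcal{L}}f_0\in V_{\mathcal{B}}$ and the system has linear response: $$\lim_{\delta\to0}\Big\|\frac{f_\delta-f_0}{\delta}-(\mathrm{Id}-\mathcal{L}_0)^{-1}\dot{\mathcal{L}}f_0\Big\|_{L^1}=0,$$ where $(\mathrm{Id}-\mathcal{L}_0)^{-1}$ denotes the resolvent acting on $V_{\mathcal{B}}$.
   Context: Let $b:\mathbb{R}^d\to\mathbb{R}^d$ satisfy (A) local Lipschitz continuity: for each $x_0\in\mathbb{R}^d$ there are $K>0$, $\delta_0>0$ with $|b(x_0)-b(x)|\le K|x_0-x|$ whenever $|x_0-x|<\delta_0$; and (B) dissipativity: there are $c_1\in\mathbb{R}$, $c_2>0$ with $\langle b(x),x\rangle\le c_1-c_2|x|^2$ for all $x\in\mathbb{R}^d$. Let $X^x_t$ be the solution of $dX_t^x=b(X_t^x)\,dt+dW_t$, $X_0^x=x$, with $W$ a standard Brownian motion in $\mathbb{R}^d$, and let $\theta_t$ be the flow of $\dot\theta=b(\theta)$. It is known that the law of $X_1^x$ has a density $\kappa(x,y)$ (in $y$, w.r.t. Lebesgue measure), continuous in $(x,y)$, and that there are constants $\lambda_0,\lambda_1\in(0,1]$, $C_0,C_1\ge 1$ such that for all $x,y$: $C_0^{-1}e^{-|\theta_1(x)-y|^2/\lambda_0}\le\kappa(x,y)\le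 C_0e^{-\lambda_0|\theta_1(x)-y|^2}$ and $|\nabla_x\kappa(x,y)|,|\nabla_y\kappa(x,y)|\le C_1e^{-\lambda_1|\theta_1(x)-y|^2}$. The transfer operator $\mathcal{L}=\mathcal{L}_0:L^1(\mathbb{R}^d)\to L^1(\mathbb{R}^d)$ is $\mathcal{L}f(y)=\int_{\mathbb{R}^d}\kappa(x,y)f(x)\,dx$. Spaces: for $\alpha\ge0$ let $\rho_\alpha(x)=(1+|x|^2)^{\alpha/2}$ and let $L^1_\alpha$ be the space of measurable $f:\mathbb{R}^d\to\mathbb{R}$ with $\|f\|_{L^1_\alpha}=\int\rho_\alpha(x)|f(x)|\,dx<\infty$. Fix a compact set $D\subset\mathbb{R}^d$ (a compact neighbourhood of $0$). The strong norm is $\|f\|_s=\|f\|_{L^1_2}+\|1_Df\|_{L^2}$ and the strong space is $\mathcal{B}=\{f\in L^1_2:\|f\|_s<\infty\}$. Set $V_{\mathcal{B}}=\{f\in\mathcal{B}:\int f\,dx=0\}$ and $V_{L^1}=\{f\in L^1:\int f\,dx=0\}$. Perturbations: fix $\bar\delta>0$. For $\delta\in[0,\bar\delta)$ let $\kappa_\delta=\kappa+\delta\dot\kappa+r_\delta$, where $\dot\kappa,r_\delta\in L^2(D\times D)$ (extended by zero outside $D\times D$), $r_0=0$, and $\|r_\delta\|_{L^2}=o(\delta)$ as $\delta\to0$. Define $\mathcal{L}_\delta f(y)=\int\kappa_\delta(x,y)f(x)\,dx$ and $\dot{\mathcal{L}}f(y)=\int\dot\kappa(x,y)f(x)\,dx$.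 Standing assumption: every $\mathcal{L}_\delta$, $\delta\in[0,\bar\delta)$, is integral preserving, i.e. $\int\mathcal{L}_\delta g\,dy=\int g\,dx$ for all $g\in L^1$. *)

(* Defs.v *)
From HB Require Import structures.
From mathcomp Require Import all_boot all_order all_algebra.
From mathcomp Require Import all_classical all_reals all_analysis.
Set Implicit Arguments. Unset Strict Implicit. Unset Printing Implicit Defensive.
Import Order.TTheory GRing.Theory Num.Theory.
Import numFieldNormedType.Exports.
Local Open Scope classical_set_scope.
Local Open Scope ring_scope.

Section Defs.
Variables (R : realType) (d : nat).

(* Euclidean inner product and norm (the mathcomp norm on matrices is the
   max-norm, so we define the Euclidean one explicitly). *)
Definition dotp (u v : 'rV[R]_d) : R := \sum_(i < d) u ord0 i * v ord0 i.
Definition sqnorm (v : 'rV[R]_d) : R := dotp v v.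
Definition enorm (v : 'rV[R]_d) : R := Num.sqrt (sqnorm v).

(* open boxes; they generate the Borel sigma-algebra of R^d *)
Definition boxes : set (set 'rV[R]_d) :=
  [set A | exists a b : 'rV[R]_d, A = [set v : 'rV[R]_d | forall i, a ord0 i < v ord0 i < b ord0 i]].

Definition Rd := g_sigma_algebraType boxes.

(* mu is (the Borel restriction of) Lebesgue measure on R^d: it gives every
   box its volume.  This characterizes mu uniquely. *)
Definition is_lebesgue (mu : {measure set Rd -> \bar R}) : Prop :=
  forall a b : 'rV[R]_d, (forall i, a ord0 i <= b ord0 i) ->
    mu [set v : 'rV[R]_d | forall i, a ord0 i < v ord0 i < b ord0 i] = (\prod_(i < d) (b ord0 i - a ord0 i))%:E.

Definition rho (alpha : R) (x : 'rV[R]_d) : R := (1 + sqnorm x) `^ (alpha / 2).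

Variable mu : {measure set Rd -> \bar R}.

Definition in_L1 (f : Rd -> R) : Prop :=
  measurable_fun setT f /\ (\int[mu]_x (`|f x|)%:E < +oo)%E.
Definition in_L1w (alpha : R) (f : Rd -> R) : Prop :=
  measurable_fun setT f /\ (\int[mu]_x (rho alpha x * `|f x|)%:E < +oo)%E.
Definition L1norm (f : Rd -> R) : \bar R := (\int[mu]_x (`|f x|)%:E)%E.
Definition integ (f : Rd -> R) : \bar R := (\int[mu]_x (f x)%:E)%E.

Definition in_B (D : set 'rV[R]_d) (f : Rd -> R) : Prop :=
  in_L1w 2 f /\ (\int[mu]_(x in (D : set Rd)) (f x ^+ 2)%:E < +oo)%E.
Definition in_VB (D : set 'rV[R]_d) (f : Rd -> R) : Prop :=
  in_B D f /\ integ f = 0%E.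

Definition in_L2DD (D : set 'rV[R]_d) (k : Rd -> Rd -> R) : Prop :=
  measurable_fun setT (fun p : (Rd * Rd)%type => k p.1 p.2) /\
  (forall x y : 'rV[R]_d, ~ (D x /\ D y) -> k x y = 0) /\
  (\int[mu]_x \int[mu]_y (k x y ^+ 2)%:E < +oo)%E.
Definition L2norm (k : Rd -> Rd -> R) : R :=
  Num.sqrt (fine (\int[mu]_x \int[mu]_y (k x y ^+ 2)%:E)%E).

Definition kop (k : Rd -> Rd -> R) (f : Rd -> R) : Rd -> R :=
  fun y => Rintegral mu setT (fun x => k x y * f x).

End Defs.

Definition gauss (R : realType) (d : nat) (s : R) (z : 'rV[R]_d) : R :=
  (2 * pi * s) `^ (- (d%:R) / 2) * expR (- sqnorm z / (2 * s)).

Definition grad (R : realType) (d : nat) (g : 'rV[R]_d -> R) (x : 'rV[R]_d) : 'rV[R]_d :=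
  \row_i ('D_(delta_mx ord0 i) g x).

(* Main.v *)
Require Import Defs.
From HB Require Import structures.
From mathcomp Require Import all_boot all_order all_algebra.
From mathcomp Require Import all_classical all_reals all_analysis.
From mathcomp Require Import measurable_realfun ring lra.
Set Implicit Arguments. Unset Strict Implicit. Unset Printing Implicit Defensive.
Import Order.TTheory GRing.Theory Num.Theory.
Import numFieldNormedType.Exports.
Local Open Scope classical_set_scope.
Local Open Scope ring_scope.

(* The kernel [kappa] is a probability density with Gaussian tails around
   [theta 1 x], and dissipativity gives
   [|theta 1 x|^2 <= exp (- 2 c2) |x|^2 + |c1| / c2]; hence [|x|^2] is a Lyapunov
   function.  The Gaussian lower bound gives a minorization on every ball, so
   by Harris' argument [L_0] contracts mean-zero functions in a weighted [L1]
   norm with weight [1 + beta |x|^2].  The resolvent is the Neumann series,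
   which converges pointwise because [kappa] is bounded.

   For the increment [v = f_delta - f_0] one has
   [v - L_0 v = (delta Kdot + R_delta) f_delta], whose norm is controlled by
   [delta |kdot| + |r_delta|] times the [L2(D)] norm of [f_delta]; since [L_0]
   maps weighted [L1] into bounded functions, this yields [v -> 0] in [L2(D)].
   Then [u = v / delta - g] solves
   [u - L_0 u = Kdot v + delta^-1 R_delta f_delta], which tends to 0. *)

(** * Integral operators with measurable kernels *)

(** The obstacle is that the densities [f_delta] come with no bound uniform in [delta], and no
    contraction is proved for the perturbed operators. Everything is therefore drawn from the
    resolvent of [L_0], and the [L2(D)] norm of [f_delta] is controlled by a circular estimate that
    closes once the perturbation is small. Two norms are needed because they do different work:
    Harris' argument contracts a weighted [L1] norm, whereas a square integrable kernel acts on
    [L2(D)]. Boundedness of [kappa] leads from the first norm to the second; compactness of [D],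
    where the images of the perturbing kernels live, leads back. The factor [beta] in the weight is
    tuned so that a single application of [L_0] contracts, without passing to iterates. For the
    resolvent to apply, the derivative term must have mean zero: this follows from conservation of
    mass tested on [f_0], divided by [delta], in the limit. *)

Lemma eq_lee (R : numDomainType) (x y : \bar R) : x = y -> (x <= y)%E.
Proof. by move=> ->. Qed.

Section NonnegativeIntegrals.
Context d (T : measurableType d) (R : realType) (mu : {measure set T -> \bar R}).

Lemma ge0_le_integral_EFin (A : set T) (f g : T -> R) :
  measurable A -> measurable_fun setT f -> measurable_fun setT g ->
  (forall x, 0 <= f x) -> (forall x, f x <= g x) ->
  (\int[mu]_(x in A) (f x)%:E <= \int[mu]_(x in A) (g x)%:E)%E.
Proof.
move=> mA mf mg f0 fg; apply: ge0_le_integral => //.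
- by move=> x _; rewrite lee_fin.
- by apply/measurable_EFinP; exact: measurable_funS mf.
- by apply/measurable_EFinP; exact: measurable_funS mg.
- by move=> x _; rewrite lee_fin.
Qed.

Lemma ge0_integralD_EFin (A : set T) (f g : T -> R) :
  measurable A -> measurable_fun setT f -> measurable_fun setT g ->
  (forall x, 0 <= f x) -> (forall x, 0 <= g x) ->
  (\int[mu]_(x in A) (f x + g x)%:E =
   \int[mu]_(x in A) (f x)%:E + \int[mu]_(x in A) (g x)%:E)%E.
Proof.
move=> mA mf mg f0 g0; under eq_integral do rewrite EFinD.
have EF h : measurable_fun setT h -> measurable_fun A (fun x => (h x)%:E).
  by move=> mh; apply/measurable_EFinP; exact: measurable_funS mh.
by apply: ge0_integralD => //; try exact: EF; move=> x _; rewrite lee_fin.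
Qed.

Lemma ge0_integralZl_EFin (A : set T) (c : R) (f : T -> R) :
  measurable A -> measurable_fun setT f -> (forall x, 0 <= f x) -> 0 <= c ->
  (\int[mu]_(x in A) (c * f x)%:E = c%:E * \int[mu]_(x in A) (f x)%:E)%E.
Proof.
move=> mA mf f0 c0; under eq_integral do rewrite EFinM.
apply: ge0_integralZl => //.
- by apply/measurable_EFinP; exact: measurable_funS mf.
- by move=> x _; rewrite lee_fin.
Qed.

Lemma cauchy_schwarz_integral (f g : T -> R) (A B : R) :
  measurable_fun setT f -> measurable_fun setT g -> 0 <= A -> 0 <= B ->
  (\int[mu]_x (f x ^+ 2)%:E <= A%:E)%E -> (\int[mu]_x (g x ^+ 2)%:E <= B%:E)%E ->
  (\int[mu]_x `|f x * g x|%:E <= (Num.sqrt (A * B))%:E)%E.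
Proof.
move=> mf mg A0 B0 fA gB.
have N2 (h : T -> R) (M : R) : 0 <= M -> (\int[mu]_x (h x ^+ 2)%:E <= M%:E)%E ->
    ('N[mu]_2%:E[EFin \o h] <= (Num.sqrt M)%:E)%E.
  move=> M0 hM; rewrite unlock /= -powR12_sqrt// -poweR_EFin.
  apply: gt0_ler_poweR; rewrite ?invr_ge0//.
  - by rewrite in_itv/= integral_ge0// leey.
  - by rewrite in_itv/= lee_fin M0 leey.
  rewrite (le_trans _ hM)//; apply: eq_lee; apply: eq_integral => x _.
  by rewrite powR_mulrn// real_normK// num_real.
have := @hoelder _ _ _ mu f g 2 2 mf mg.
rewrite Lnorm1 /= => H; apply: (le_trans (H _ _ _)) => //; first by lra.
rewrite sqrtrM// EFinM lee_pmul ?Lnorm_ge0//; exact: N2.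
Qed.

End NonnegativeIntegrals.

Section IntegralOperator.
Context d (T : measurableType d) (R : realType).
Variable mu : {sigma_finite_measure set T -> \bar R}.

(** This is [kop] over an arbitrary measurable space. [Rintegral] is the [fine] part of an extended
    integral, so the value is 0 wherever that integral is infinite. *)
Definition intop (k : T -> T -> R) (f : T -> R) : T -> R :=
  fun y => Rintegral mu setT (fun x => k x y * f x).

(** Since [fine] sends both infinities to 0, absolute bounds on [intop] hold without any
    integrability hypothesis. *)
Lemma abse_fine_le (z : \bar R) : (`|fine z|%:E <= `|z|)%E.
Proof. by case: z => [r| |] //=; rewrite ?normr0 ?leey. Qed.

Lemma measurable_swap_args (k : T -> T -> R) :
  measurable_fun setT (fun p : T * T => k p.1 p.2) ->
  measurable_fun setT (fun p : T * T => k p.2 p.1).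
Proof.
move=> mk; rewrite [X in measurable_fun _ X](_ : _ =
  (fun p => k p.1 p.2) \o (fun p => (p.2, p.1)))//.
by apply: (measurableT_comp mk); exact: measurable_fun_pair.
Qed.

Lemma measurable_section1 (k : T -> T -> R) y :
  measurable_fun setT (fun p : T * T => k p.1 p.2) -> measurable_fun setT (k ^~ y).
Proof.
move=> mk; rewrite [X in measurable_fun _ X](_ : _ =
  (fun p => k p.1 p.2) \o (fun x => (x, y)))//.
by apply: (measurableT_comp mk); exact: measurable_fun_pair.
Qed.

Lemma measurable_section2 (k : T -> T -> R) x :
  measurable_fun setT (fun p : T * T => k p.1 p.2) -> measurable_fun setT (k x).
Proof. by move=> /measurable_swap_args mk; exact: (@measurable_section1 (fun y x => k x y)). Qed.

Lemma measurable_integral1 (k : T -> T -> R) :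
  measurable_fun setT (fun p : T * T => k p.1 p.2) -> (forall x y, 0 <= k x y) ->
  measurable_fun setT ((fun y => \int[mu]_x (k x y)%:E)%E : T -> \bar R).
Proof.
move=> mk k0.
apply: (measurable_fun_fubini_tonelli_G (fun p => (k p.1 p.2)%:E)).
  exact/measurable_EFinP.
by move=> p; rewrite lee_fin.
Qed.

Lemma measurable_integral2 (k : T -> T -> R) :
  measurable_fun setT (fun p : T * T => k p.1 p.2) -> (forall x y, 0 <= k x y) ->
  measurable_fun setT ((fun x => \int[mu]_y (k x y)%:E)%E : T -> \bar R).
Proof.
move=> /measurable_swap_args mk k0.
exact: (@measurable_integral1 (fun y x => k x y)).
Qed.

Lemma tonelli (k : T -> T -> R) :
  measurable_fun setT (fun p : T * T => k p.1 p.2) -> (forall x y, 0 <= k x y) ->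
  (\int[mu]_x \int[mu]_y (k x y)%:E = \int[mu]_y \int[mu]_x (k x y)%:E)%E.
Proof.
move=> mk k0; apply: (fubini_tonelli (fun p => (k p.1 p.2)%:E)).
  exact/measurable_EFinP.
by move=> p; rewrite lee_fin.
Qed.

Lemma measurable_kernelM (k : T -> T -> R) (f : T -> R) :
  measurable_fun setT (fun p : T * T => k p.1 p.2) -> measurable_fun setT f ->
  measurable_fun setT (fun p : T * T => k p.1 p.2 * f p.1).
Proof. by move=> mk mf; apply: measurable_funM => //; exact: measurableT_comp. Qed.

(** Tonelli makes the integrals of the positive and negative parts measurable in [y]; their
    difference and its [fine] part stay measurable, even where the integral is not finite. *)
Lemma measurable_intop (k : T -> T -> R) (f : T -> R) :
  measurable_fun setT (fun p : T * T => k p.1 p.2) -> measurable_fun setT f ->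
  measurable_fun setT (intop k f).
Proof.
move=> mk mf; have mkf := measurable_kernelM mk mf.
rewrite /intop /Rintegral; apply: measurableT_comp => //.
under eq_fun do rewrite integralE.
apply: emeasurable_funB.
- pose kp x y := Num.max (k x y * f x) 0.
  rewrite [X in measurable_fun _ X](_ : _ = fun y => (\int[mu]_x (kp x y)%:E)%E).
    apply: measurable_integral1 => [|x y]; last by rewrite /kp le_max lexx orbT.
    by apply: measurable_maxr.
  by apply/funext => y; apply: eq_integral => x _; rewrite funeposE /kp EFin_max.
- pose kn x y := Num.max (- (k x y * f x)) 0.
  rewrite [X in measurable_fun _ X](_ : _ = fun y => (\int[mu]_x (kn x y)%:E)%E).
    apply: measurable_integral1 => [|x y]; last by rewrite /kn le_max lexx orbT.
    by apply: measurable_maxr => //; exact: measurableT_comp.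
  by apply/funext => y; apply: eq_integral => x _; rewrite funenegE /kn EFin_max.
Qed.

Lemma normr_intop_le (k : T -> T -> R) (f : T -> R) y :
  measurable_fun setT (fun p : T * T => k p.1 p.2) -> measurable_fun setT f ->
  (`|intop k f y|%:E <= \int[mu]_x (`|k x y| * `|f x|)%:E)%E.
Proof.
move=> mk mf; apply: (le_trans (abse_fine_le _)).
apply: (le_trans (le_abse_integral _ _ _)) => //.
  by apply/measurable_EFinP/measurable_funM => //; exact: measurable_section1.
by under eq_integral do rewrite /= normrM.
Qed.

Lemma integral_intop_le (w : T -> R) (k : T -> T -> R) (f : T -> R) :
  measurable_fun setT w -> (forall y, 0 <= w y) ->
  measurable_fun setT (fun p : T * T => k p.1 p.2) -> measurable_fun setT f ->
  (\int[mu]_y (w y * `|intop k f y|)%:E <=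
   \int[mu]_x ((\int[mu]_y (w y * `|k x y|)%:E) * `|f x|%:E))%E.
Proof.
move=> mw w0 mk mf.
have mk' := measurableT_comp (@normr_measurable R setT) mk.
have mf' := measurableT_comp (@normr_measurable R setT) mf.
have mwk : measurable_fun setT (fun p : T * T => w p.2 * `|k p.1 p.2|).
  by apply: measurable_funM => //; exact: measurableT_comp.
have mwkf := @measurable_kernelM (fun x y => w y * `|k x y|) _ mwk mf'.
apply: (@le_trans _ _ (\int[mu]_y \int[mu]_x (w y * `|k x y| * `|f x|)%:E)%E).
  apply: ge0_le_integral => //.
  - by move=> y _; rewrite lee_fin mulr_ge0.
  - apply/measurable_EFinP/measurable_funM => //; apply: measurableT_comp => //.
    exact: measurable_intop.
  - apply: (@measurable_integral1 (fun x y => w y * `|k x y| * `|f x|)) => //.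
    by move=> x y; rewrite !mulr_ge0.
  move=> y _; rewrite EFinM.
  apply: (le_trans (lee_wpmul2l _ (normr_intop_le _ mk mf))); first by rewrite lee_fin.
  rewrite -ge0_integralZl//.
  - by apply: eq_lee; apply: eq_integral => x _; rewrite -EFinM mulrA.
  - apply/measurable_EFinP/measurable_funM => //.
    by apply: measurableT_comp => //; exact: measurable_section1.
  - by rewrite lee_fin.
rewrite -(@tonelli (fun x y => w y * `|k x y| * `|f x|)); last 2 first.
- by [].
- by move=> x y; rewrite !mulr_ge0.
apply: eq_lee; apply: eq_integral => x _.
rewrite -ge0_integralZr// => [|y _]; last by rewrite lee_fin mulr_ge0.
apply/measurable_EFinP; exact: (@measurable_section2 (fun x y => w y * `|k x y|) x).
Qed.

(** Operators are estimated through the dual action of the kernel on weights. Harris' argument uses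
    it with [w] constant for the mass and with [w] equal to [V] for the drift. *)
Lemma integral_intop_le_weight (w c : T -> R) (k : T -> T -> R) (f : T -> R) :
  measurable_fun setT w -> (forall y, 0 <= w y) ->
  measurable_fun setT (fun p : T * T => k p.1 p.2) -> measurable_fun setT f ->
  measurable_fun setT c ->
  (forall x, \int[mu]_y (w y * `|k x y|)%:E <= (c x)%:E)%E ->
  (\int[mu]_y (w y * `|intop k f y|)%:E <= \int[mu]_x (c x * `|f x|)%:E)%E.
Proof.
move=> mw w0 mk mf mc wc; apply: (le_trans (integral_intop_le mw w0 mk mf)).
have wk0 x : (0 <= \int[mu]_y (w y * `|k x y|)%:E)%E.
  by apply: integral_ge0 => y _; rewrite lee_fin mulr_ge0.
have mnf := measurableT_comp (@normr_measurable R setT) mf.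
apply: ge0_le_integral => //.
- by move=> x _; rewrite mule_ge0// lee_fin.
- apply: emeasurable_funM; last exact/measurable_EFinP.
  apply: (@measurable_integral2 (fun x y => w y * `|k x y|)).
    apply: measurable_funM; first exact: measurableT_comp.
    exact: measurableT_comp.
  by move=> x y; rewrite mulr_ge0.
- exact/measurable_EFinP/measurable_funM.
- by move=> x _; rewrite EFinM lee_wpmul2r// lee_fin.
Qed.

End IntegralOperator.

(** * Harris' contraction *)

Section Harris.
Context d (T : measurableType d) (R : realType).
Variable mu : {sigma_finite_measure set T -> \bar R}.

Lemma integrable_kernelM (k : T -> T -> R) (f : T -> R) (C : R) y :
  measurable_fun setT (fun p : T * T => k p.1 p.2) ->
  (forall x y, 0 <= k x y <= C) -> mu.-integrable setT (EFin \o f) ->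
  mu.-integrable setT (EFin \o (fun x => k x y * f x)).
Proof.
move=> mk kC intf; have mf : measurable_fun setT f.
  by apply/measurable_EFinP; exact: (measurable_int mu).
apply: (@le_integrable _ _ _ mu _ measurableT _ (fun x => C%:E * (f x)%:E)%E).
- by apply/measurable_EFinP/measurable_funM => //; exact: measurable_section1.
- move=> x _; rewrite /= lee_fin !normrM ler_wpM2r//.
  by have /andP[k0 kCx] := kC x y; rewrite !ger0_norm// (le_trans k0).
- exact: integrableZl.
Qed.

Lemma intop_subr_mean0 (k : T -> T -> R) (h f : T -> R) (C : R) y :
  measurable_fun setT (fun p : T * T => k p.1 p.2) ->
  (forall x y, 0 <= k x y <= C) -> mu.-integrable setT (EFin \o f) ->
  (\int[mu]_x (f x)%:E = 0)%E ->
  intop mu (fun x y => k x y - h y) f y = intop mu k f y.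
Proof.
move=> mk kC intf f0; rewrite /intop; under eq_Rintegral do rewrite mulrBl.
rewrite RintegralB//; last 2 first.
- exact: integrable_kernelM kC intf.
- rewrite (_ : _ \o _ = fun x => (h y)%:E * (f x)%:E)%E; first exact: integrableZl.
  by apply/funext => x /=; rewrite EFinM.
by rewrite RintegralZl// [X in _ * X](_ : _ = 0) ?mulr0 ?subr0// /Rintegral f0.
Qed.

(* Since [f] has mean zero, [intop k f = intop (k - h) f] for any [h] not
   depending on the first variable; with [h] a minorant of [k] on a sublevel
   set of [V], the kernel [k - h] has total mass less than 1 there, and the
   Lyapunov condition takes care of the complement. *)
Lemma harris_contraction (k : T -> T -> R) (V : T -> R) (C gamma K : R) :
  measurable_fun setT (fun p : T * T => k p.1 p.2) ->
  (forall x y, 0 <= k x y <= C) ->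
  (forall x, \int[mu]_y (k x y)%:E = 1)%E ->
  measurable_fun setT V -> (forall x, 0 <= V x) ->
  0 <= gamma < 1 -> 1 <= K ->
  (forall x, \int[mu]_y (V y * k x y)%:E <= (gamma * V x + K)%:E)%E ->
  (forall r, exists (a : R) (h : T -> R), [/\ 0 < a <= 1, measurable_fun setT h,
     (forall y, 0 <= h y), (\int[mu]_y (h y)%:E = a%:E)%E &
     forall x y, V x <= r -> h y <= k x y]) ->
  exists beta q : R, [/\ 0 < beta <= 1, 0 <= q < 1 & forall f : T -> R,
    measurable_fun setT f -> (\int[mu]_x ((1 + V x) * `|f x|)%:E < +oo)%E ->
    (\int[mu]_x (f x)%:E = 0)%E ->
    (\int[mu]_x ((1 + beta * V x) * `|intop mu k f x|)%:E <=
     q%:E * \int[mu]_x ((1 + beta * V x) * `|f x|)%:E)%E].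
Proof.
move=> mk kC k1 mV V0 /andP[g0 g1] K1 lyap minor.
have K0 : 0 < K by lra.
have h1g : 0 < 1 - gamma by lra.
(* The constants are tuned together. With [beta = a / (2 * K)] the drift constant costs
   [beta * K = a / 2], half of the mass gained by minorization; this [r] makes the slope [2 * a / r]
   half of the gain [beta * (1 - gamma)]. What remains are the two rates [1 - a / 2] and
   [(1 + gamma) / 2], whose maximum is [q]. *)
pose r := 8 * K / (1 - gamma).
have r0 : 0 < r by rewrite divr_gt0// mulr_gt0.
have [a [h [/andP[a0 a1] mh h0 inth hk]]] := minor r.
pose beta := a / (2 * K).
have beta0 : 0 < beta by rewrite divr_gt0// mulr_gt0.
have beta1 : beta <= 1 by rewrite ler_pdivrMr ?mulr_gt0//; lra.
have bK : beta * K = a / 2 by rewrite /beta; field; rewrite gt_eqF.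
have ar : 2 * a / r = beta * ((1 - gamma) / 2).
  by rewrite /r /beta; field; rewrite !gt_eqF.
clearbody r beta; pose q := Num.max (1 - a / 2) ((1 + gamma) / 2).
have q0 : 0 <= q by rewrite /q le_max; apply/orP; left; lra.
have q1 : q < 1 by rewrite /q gt_max; apply/andP; split; lra.
exists beta, q; split; rewrite ?beta0 ?q0//= => f mf finf f0.
have intf : mu.-integrable setT (EFin \o f).
  apply/integrableP; split; first exact/measurable_EFinP.
  apply: le_lt_trans finf; apply: ge0_le_integral_EFin => //.
  - exact: measurableT_comp.
  - by apply: measurable_funM; [exact: measurable_funD|exact: measurableT_comp].
  - by move=> x; rewrite ler_peMl// lerDl.
have mnf : measurable_fun setT (fun x => `|f x|) by exact: measurableT_comp.
have mKf := measurable_intop mu mk mf.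
have mnKf : measurable_fun setT (fun x => `|intop mu k f x|) by exact: measurableT_comp.
have mkh : measurable_fun setT (fun p : T * T => k p.1 p.2 - h p.2).
  by apply: measurable_funB => //; exact: measurableT_comp.
have mass x : (\int[mu]_y (1 * `|k x y - h y|)%:E <= (1 - a + 2 * a / r * V x)%:E)%E.
  (* One affine function of [V] serves both regimes: [c >= -1] always, enough where [h] minorizes
     [k], and [c >= 1] once [V x > r], where only the triangle inequality is left. *)
  pose c := 2 / r * V x - 1.
  have c1 : -1 <= c by rewrite /c lerDr mulr_ge0// divr_ge0// ltW.
  have kh y : `|k x y - h y| <= k x y + c * h y.
    have /andP[k0 _] := kC x y; have := h0 y => hy0.
    have chy : - h y <= c * h y by rewrite -mulN1r ler_wpM2r.
    have [Vr|rV] := leP (V x) r; first by rewrite ger0_norm ?subr_ge0 ?hk// lerD2l.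
    have c1' : 1 <= c.
      rewrite /c lerBrDr -[X in X <= _](_ : 2 / r * r = _); last first.
        by field; rewrite gt_eqF.
      by apply: ler_wpM2l (ltW rV); rewrite divr_ge0// ltW.
    have : h y <= c * h y by rewrite ler_peMl.
    move=> hch; apply: (le_trans (ler_normB _ _)).
    by rewrite !ger0_norm// lerD2l.
  have mkx := measurable_section2 x mk.
  have intk : mu.-integrable setT (EFin \o k x).
    apply/integrableP; split; first exact/measurable_EFinP.
    under eq_integral do rewrite /= ger0_norm ?(andP (kC _ _)).1//.
    by rewrite k1 ltry.
  have inth' : mu.-integrable setT (EFin \o h).
    apply/integrableP; split; first exact/measurable_EFinP.
    by under eq_integral do rewrite /= ger0_norm//; rewrite inth ltry.
  apply: (@le_trans _ _ (\int[mu]_y (k x y + c * h y)%:E)%E).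
    apply: ge0_le_integral_EFin => //.
    - apply: measurable_funM => //; apply: measurableT_comp => //.
      exact: measurable_funB.
    - by apply: measurable_funD => //; exact: measurable_funM.
    - by move=> y; rewrite mul1r.
  under eq_integral do rewrite EFinD EFinM.
  rewrite integralD//; last exact: integrableZl.
  rewrite integralZl// k1 inth -EFinM -EFinD lee_fin /c.
  suff -> : 1 + (2 / r * V x - 1) * a = 1 - a + 2 * a / r * V x by [].
  by ring.
(* Only the unweighted part gains from subtracting [h]. The part weighted by [V] is estimated with
   [k] itself, and its constant [K] is paid for by the smallness of [beta]. *)
have KA : (\int[mu]_y `|intop mu k f y|%:E <=
    \int[mu]_x ((1 - a + 2 * a / r * V x) * `|f x|)%:E)%E.
  under eq_integral => y _.
    rewrite -(intop_subr_mean0 h y mk kC intf f0) -[X in X%:E]mul1r; over.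
  apply: (@integral_intop_le_weight _ _ _ mu (cst 1) _ (fun x y => k x y - h y)) => //.
  by apply: measurable_funD => //; exact: measurable_funM.
have KB : (\int[mu]_y (V y * `|intop mu k f y|)%:E <=
    \int[mu]_x ((gamma * V x + K) * `|f x|)%:E)%E.
  apply: integral_intop_le_weight => //.
    by apply: measurable_funD => //; exact: measurable_funM.
  move=> x; under eq_integral do rewrite ger0_norm ?(andP (kC _ _)).1//.
  exact: lyap.
under eq_integral do rewrite mulrDl mul1r -mulrA.
have mVf : measurable_fun setT (fun x => V x * `|intop mu k f x|) by exact: measurable_funM.
rewrite ge0_integralD_EFin//; last 2 first.
- exact: measurable_funM.
- by move=> x; rewrite !mulr_ge0// ltW.
rewrite ge0_integralZl_EFin//; [|by move=> x; rewrite mulr_ge0|exact: ltW].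
apply: (le_trans (leeD KA (lee_wpmul2l _ KB))); first by rewrite lee_fin ltW.
have mA : measurable_fun setT (fun x => (1 - a + 2 * a / r * V x) * `|f x|).
  by apply: measurable_funM => //; apply: measurable_funD => //; exact: measurable_funM.
have mB : measurable_fun setT (fun x => (gamma * V x + K) * `|f x|).
  by apply: measurable_funM => //; apply: measurable_funD => //; exact: measurable_funM.
have A0 x : 0 <= (1 - a + 2 * a / r * V x) * `|f x|.
  rewrite mulr_ge0// addr_ge0 ?subr_ge0// mulr_ge0// divr_ge0 ?mulr_ge0 ?ltW//.
have B0 x : 0 <= (gamma * V x + K) * `|f x|.
  by rewrite mulr_ge0// addr_ge0 ?mulr_ge0// ltW.
have mW : measurable_fun setT (fun x => (1 + beta * V x) * `|f x|).
  by apply: measurable_funM => //; apply: measurable_funD => //; exact: measurable_funM.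
have W0 x : 0 <= (1 + beta * V x) * `|f x|.
  by rewrite mulr_ge0// addr_ge0// mulr_ge0// ltW.
rewrite -!ge0_integralZl_EFin//; last exact: ltW.
rewrite -ge0_integralD_EFin//; last 2 first.
- exact: measurable_funM.
- by move=> x; rewrite mulr_ge0// ltW.
under eq_integral do rewrite mulrA -mulrDl.
under [leRHS]eq_integral do rewrite mulrA.
apply: ge0_le_integral_EFin => //.
- apply: measurable_funM => //; apply: measurable_funD.
    by apply: measurable_funD => //; exact: measurable_funM.
  apply: measurable_funM => //.
  by apply: measurable_funD => //; exact: measurable_funM.
- apply: measurable_funM => //; apply: measurable_funM => //.
  by apply: measurable_funD => //; exact: measurable_funM.
- move=> x; rewrite mulr_ge0// addr_ge0//.
    by rewrite addr_ge0 ?subr_ge0// mulr_ge0// divr_ge0 ?mulr_ge0 ?ltW.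
  by apply: mulr_ge0; [exact: ltW|rewrite addr_ge0 ?mulr_ge0// ltW].
- move=> x; rewrite ler_wpM2r// ar.
  rewrite [leLHS](_ : _ = (1 - a + beta * K) + (1 + gamma) / 2 * (beta * V x)); last by field.
  rewrite bK mulrDr mulr1 lerD//.
    by rewrite /q le_max; apply/orP; left; lra.
  by rewrite ler_wpM2r// ?mulr_ge0 ?(ltW beta0)// /q le_max lexx orbT.
Qed.

End Harris.

(** * Weighted L1 spaces *)

Section WeightedSpace.
Context d (T : measurableType d) (R : realType).
Variable mu : {sigma_finite_measure set T -> \bar R}.
Variable w : T -> R.
Hypothesis mw : measurable_fun setT w.
Hypothesis w1 : forall x, 1 <= w x.

Definition wnorm (f : T -> R) : \bar R := (\int[mu]_x (w x * `|f x|)%:E)%E.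
Definition inW (f : T -> R) := measurable_fun setT f /\ (wnorm f < +oo)%E.
Definition nW (f : T -> R) : R := fine (wnorm f).

Implicit Types f g : T -> R.

Let w0 x : 0 <= w x. Proof. by rewrite (le_trans _ (w1 x)). Qed.

Lemma measurable_wnorm_integrand f : measurable_fun setT f ->
  measurable_fun setT (fun x => w x * `|f x|).
Proof. by move=> mf; apply: measurable_funM => //; exact: measurableT_comp. Qed.

Lemma wnorm_ge0 f : (0 <= wnorm f)%E.
Proof. by apply: integral_ge0 => x _; rewrite lee_fin mulr_ge0. Qed.

Lemma nW_ge0 f : 0 <= nW f.
Proof. by rewrite fine_ge0// wnorm_ge0. Qed.

Lemma wnormE f : inW f -> wnorm f = (nW f)%:E.
Proof. by move=> [_ f1]; rewrite fineK// ge0_fin_numE// wnorm_ge0. Qed.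

Lemma wnorm_le_inW f (A : R) : measurable_fun setT f -> (wnorm f <= A%:E)%E ->
  inW f /\ nW f <= A.
Proof.
move=> mf fA; have f1 : inW f by split=> //; apply: le_lt_trans fA (ltry _).
by split=> //; rewrite -lee_fin -wnormE.
Qed.

Lemma L1norm_le_wnorm f : measurable_fun setT f ->
  (\int[mu]_x `|f x|%:E <= wnorm f)%E.
Proof.
move=> mf; apply: ge0_le_integral_EFin => //.
- exact: measurableT_comp.
- exact: measurable_wnorm_integrand.
- by move=> x; rewrite ler_peMl.
Qed.

Lemma inW_integrable f : inW f -> mu.-integrable setT (EFin \o f).
Proof.
move=> [mf f1]; apply/integrableP; split; first exact/measurable_EFinP.
exact: le_lt_trans (L1norm_le_wnorm mf) f1.
Qed.

Lemma integralE_inW f : inW f -> (\int[mu]_x (f x)%:E = (Rintegral mu setT f)%:E)%E.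
Proof.
by move=> /inW_integrable fi; rewrite fineK//; exact: integrable_fin_num.
Qed.

Lemma normr_integral_le_nW f : inW f -> `|Rintegral mu setT f| <= nW f.
Proof.
move=> fW; rewrite -lee_fin -wnormE//; apply: (le_trans (abse_fine_le _)).
apply: (le_trans (le_abse_integral _ _ _)) => //.
  by apply/measurable_EFinP; case: fW.
by apply: L1norm_le_wnorm; case: fW.
Qed.

Lemma wnormD f g : inW f -> inW g ->
  inW (fun x => f x + g x) /\ nW (fun x => f x + g x) <= nW f + nW g.
Proof.
move=> fW gW; have [mf _] := fW; have [mg _] := gW.
apply: wnorm_le_inW; first exact: measurable_funD.
rewrite EFinD -!wnormE// /wnorm -ge0_integralD_EFin//; last 4 first.
- exact: measurable_wnorm_integrand.
- exact: measurable_wnorm_integrand.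
- by move=> x; rewrite mulr_ge0.
- by move=> x; rewrite mulr_ge0.
apply: ge0_le_integral_EFin => //.
- by apply: measurable_wnorm_integrand; exact: measurable_funD.
- by apply: measurable_funD; exact: measurable_wnorm_integrand.
- by move=> x; rewrite mulr_ge0.
- by move=> x; rewrite -mulrDr ler_wpM2l// ler_normD.
Qed.

Lemma wnormZ c f : inW f ->
  inW (fun x => c * f x) /\ nW (fun x => c * f x) = `|c| * nW f.
Proof.
move=> fW; have [mf _] := fW.
have E : wnorm (fun x => c * f x) = (`|c| * nW f)%:E.
  rewrite EFinM -wnormE// -ge0_integralZl_EFin//.
  - by apply: eq_integral => x _; rewrite normrM mulrCA.
  - exact: measurable_wnorm_integrand.
  - by move=> x; rewrite mulr_ge0.
split; last by rewrite /nW E.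
by split; [exact: measurable_funM|rewrite E ltry].
Qed.

Lemma wnormB f g : inW f -> inW g ->
  inW (fun x => f x - g x) /\ nW (fun x => f x - g x) <= nW f + nW g.
Proof.
move=> fW /(wnormZ (-1)) [gW ng]; have [] := wnormD fW gW.
rewrite ng normrN1 mul1r (_ : (fun x => f x + -1 * g x) = (fun x => f x - g x))//.
by apply/funext => x; rewrite mulN1r.
Qed.

Lemma wnorm_ae f g : measurable_fun setT f -> measurable_fun setT g ->
  {ae mu, forall x, f x = g x} -> wnorm f = wnorm g.
Proof.
move=> mf mg fg; apply: ge0_ae_eq_integral => //.
- exact/measurable_EFinP/measurable_wnorm_integrand.
- exact/measurable_EFinP/measurable_wnorm_integrand.
- by move=> x _; rewrite lee_fin mulr_ge0.
- by move=> x _; rewrite lee_fin mulr_ge0.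
- by apply: filterS fg => x + _ => ->.
Qed.

Lemma nW0_ae f : inW f -> nW f = 0 -> {ae mu, forall x, f x = 0}.
Proof.
move=> fW f0; have := wnormE fW; rewrite f0 => E0; have [mf _] := fW.
have m1 : measurable_fun setT (fun x => (w x * `|f x|)%:E).
  exact/measurable_EFinP/measurable_wnorm_integrand.
have /(ae_eq_integral_abs mu measurableT m1) : (\int[mu]_x `|(w x * `|f x|)%:E| = 0)%E.
  by apply: etrans E0; apply: eq_integral => x _ /=; rewrite ger0_norm// mulr_ge0.
apply: filterS => x /(_ I) [] /eqP; rewrite mulf_eq0 normr_eq0 => /orP[|/eqP//].
by rewrite gt_eqF// (lt_le_trans _ (w1 x)).
Qed.

(** Fatou's lemma. It stands in for completeness of the weighted space: a limit built pointwise
    inherits the norm bound of the sequence. *)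
Lemma wnorm_lim (f : nat -> T -> R) g (A : R) :
  (forall n, measurable_fun setT (f n)) -> (forall n, (wnorm (f n) <= A%:E)%E) ->
  (forall x, f n x @[n --> \oo] --> g x) ->
  inW g /\ nW g <= A.
Proof.
move=> mf fA fg.
have mg : measurable_fun setT g.
  by apply: (measurable_fun_cvg (fun n => mf n)) => x _; exact: fg.
apply: wnorm_le_inW => //.
pose F n x := (w x * `|f n x|)%:E.
have FE x : (w x * `|g x|)%:E = limn_einf (F^~ x).
  have cF : F n x @[n --> \oo] --> (w x * `|g x|)%:E.
    apply: cvg_EFin; first exact: nearW.
    by apply: cvgM; [exact: cvg_cst|apply: cvg_norm; exact: fg].
  rewrite (is_cvg_limn_einfE _); first by rewrite (cvg_lim _ cF).
  by apply/cvg_ex; eexists; exact: cF.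
rewrite /wnorm; under eq_integral do rewrite FE.
apply: (le_trans (fatou mu measurableT _ _)).
- by move=> n; exact/measurable_EFinP/measurable_wnorm_integrand.
- by move=> n x _; rewrite lee_fin mulr_ge0.
rewrite limn_einf_lim; apply: lime_le; first exact: is_cvg_einfs.
apply: nearW => n; apply: le_trans (fA n).
by apply: ereal_inf_lbound; exists n => /=.
Qed.

End WeightedSpace.

(** * The resolvent on mean-zero functions *)

Section Resolvent.
Context d (T : measurableType d) (R : realType).
Variable mu : {sigma_finite_measure set T -> \bar R}.
Variables (w : T -> R) (k : T -> T -> R) (C q : R).
Hypothesis mw : measurable_fun setT w.
Hypothesis w1 : forall x, 1 <= w x.
Hypothesis mk : measurable_fun setT (fun p : T * T => k p.1 p.2).
Hypothesis kC : forall x y, 0 <= k x y <= C.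
Hypothesis q01 : 0 <= q < 1.

Local Notation inW := (inW mu w).
Local Notation nW := (nW mu w).
Local Notation L := (intop mu k).
Implicit Types f g h : T -> R.

Definition inW0 f := inW f /\ (\int[mu]_x (f x)%:E = 0)%E.

Hypothesis pres : forall g, inW g -> (\int[mu]_x (L g x)%:E = \int[mu]_x (g x)%:E)%E.
Hypothesis contr : forall g, inW0 g ->
  (wnorm mu w (L g) <= q%:E * wnorm mu w g)%E.

Let C0 : 0 <= C.
Proof. by have /andP[a /(le_trans a)] := kC point point. Qed.

Lemma inW0P f : inW f -> (\int[mu]_x (f x)%:E = 0)%E <-> Rintegral mu setT f = 0.
Proof.
move=> fW; rewrite (integralE_inW mw w1 fW).
by split=> [[]|->].
Qed.

Lemma Rintegral_inWD f g : inW f -> inW g ->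
  Rintegral mu setT (fun x => f x + g x) = Rintegral mu setT f + Rintegral mu setT g.
Proof.
by move=> /(inW_integrable mw w1) fi /(inW_integrable mw w1) gi; rewrite RintegralD.
Qed.

Lemma Rintegral_inWZ c f : inW f ->
  Rintegral mu setT (fun x => c * f x) = c * Rintegral mu setT f.
Proof. by move=> /(inW_integrable mw w1) fi; rewrite RintegralZl. Qed.

Lemma inW0D f g : inW0 f -> inW0 g -> inW0 (fun x => f x + g x).
Proof.
move=> [fW f0] [gW g0]; have [fgW _] := wnormD mw w1 fW gW.
split => //; apply/inW0P => //; rewrite Rintegral_inWD//.
by move/inW0P : f0 => ->//; move/inW0P : g0 => ->//; rewrite addr0.
Qed.

Lemma inW0Z c f : inW0 f -> inW0 (fun x => c * f x).
Proof.
move=> [fW f0]; have [cfW _] := wnormZ mw w1 c fW.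
split => //; apply/inW0P => //; rewrite Rintegral_inWZ//.
by move/inW0P : f0 => ->//; rewrite mulr0.
Qed.

Lemma inW0B f g : inW0 f -> inW0 g -> inW0 (fun x => f x - g x).
Proof.
move=> f0 /(inW0Z (-1)) /(inW0D f0); congr inW0.
by apply/funext => x; rewrite mulN1r.
Qed.

Lemma inW0_intop f : inW0 f -> inW0 (L f) /\ nW (L f) <= q * nW f.
Proof.
move=> f0; have [fW If] := f0; have [mf _] := fW.
have [LW nL] : inW (L f) /\ nW (L f) <= q * nW f.
  apply: wnorm_le_inW => //; first exact: measurable_intop.
  by rewrite EFinM -wnormE//; exact: contr.
by do 2 split => //; rewrite pres.
Qed.

(** This smoothing effect of a bounded kernel turns smallness in norm into smallness at every point.
    It makes the Neumann series converge pointwise, allows limits under [L], and later gives the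
    [L2(D)] bounds. *)
Lemma normr_intop_le_nW f y : inW f -> `|L f y| <= C * nW f.
Proof.
move=> fW; have [mf _] := fW; have mnf := measurableT_comp (@normr_measurable R setT) mf.
rewrite -lee_fin; apply: (le_trans (normr_intop_le _ _ mk mf)).
rewrite EFinM -wnormE// -ge0_integralZl_EFin//; last 2 first.
- exact: measurable_wnorm_integrand.
- by move=> x; rewrite mulr_ge0// (le_trans _ (w1 x)).
apply: ge0_le_integral_EFin => //.
- apply: measurable_funM => //.
  by apply: measurableT_comp => //; exact: measurable_section1.
- by apply: measurable_funM => //; exact: measurable_wnorm_integrand.
- move=> x; have /andP[k0 kCx] := kC x y.
  by apply: ler_pM => //; [rewrite ger0_norm|rewrite ler_peMl].
Qed.

Lemma integrable_inW_kernel f y : inW f ->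
  mu.-integrable setT (EFin \o (fun x => k x y * f x)).
Proof. by move=> /(inW_integrable mw w1); exact: integrable_kernelM mk kC. Qed.

Lemma intopD f g y : inW f -> inW g -> L (fun x => f x + g x) y = L f y + L g y.
Proof.
move=> fW gW; rewrite /intop -RintegralD//; try exact: integrable_inW_kernel.
by apply: eq_Rintegral => x _; rewrite mulrDr.
Qed.

Lemma intopZ c f y : inW f -> L (fun x => c * f x) y = c * L f y.
Proof.
move=> fW; rewrite /intop -RintegralZl//; last exact: integrable_inW_kernel.
by apply: eq_Rintegral => x _; rewrite mulrCA.
Qed.

Lemma intopB f g y : inW f -> inW g -> L (fun x => f x - g x) y = L f y - L g y.
Proof.
move=> fW gW; rewrite /intop -RintegralB//; try exact: integrable_inW_kernel.
by apply: eq_Rintegral => x _; rewrite mulrBr.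
Qed.

(** As [nW f] is finite, the term [q * nW f] coming from [L f] can be absorbed on the left. An
    equation valid almost everywhere suffices, which is how invariance of a density is given. *)
Lemma resolvent_bound f h : inW0 f -> inW h ->
  {ae mu, forall y, f y = L f y + h y} -> nW f <= (1 - q)^-1 * nW h.
Proof.
move=> f0 hW fE; have [[mf _] _] := f0; have [[LW _] nL] := inW0_intop f0.
have [SW nS] := wnormD mw w1 LW hW.
have E : nW f = nW (fun y => L f y + h y).
  by congr fine; apply: wnorm_ae => //; case: SW.
have /andP[_ q1] := q01.
rewrite ler_pdivlMl ?subr_gt0// mulrBl mul1r lerBlDl.
by rewrite {1}E (le_trans nS)// lerD2r.
Qed.

Lemma resolvent_unique f g h : inW0 f -> inW0 g ->
  {ae mu, forall y, f y - L f y = h y} -> {ae mu, forall y, g y - L g y = h y} ->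
  {ae mu, forall y, f y = g y}.
Proof.
move=> f0 g0 fh gh; have fg0 := inW0B f0 g0.
(* The zero function is written as a multiple by 0, so that [wnormZ] supplies both its membership
   and its norm. *)
have [z0 nz] := wnormZ mw w1 0 fg0.1.
have : nW (fun x => f x - g x) = 0.
  apply/eqP; rewrite eq_le nW_ge0// andbT.
  have := resolvent_bound fg0 z0; rewrite nz normr0 mul0r mulr0; apply.
  apply: filterS2 fh gh => y fy gy.
  by rewrite mul0r addr0 intopB ?f0.1 ?g0.1//; [lra|case: f0|case: g0].
move=> /(nW0_ae mw w1 fg0.1); apply: filterS => y /eqP.
by rewrite subr_eq0 => /eqP.
Qed.

Lemma le_geometric_cvg (x : nat -> R) (l c : R) :
  (forall n, `|l - x n| <= c * q ^+ n) -> x n @[n --> \oo] --> l.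
Proof.
move=> xc; have /andP[q0 q1] := q01.
have /cvgrPdist_le cv : geometric c q n @[n --> \oo] --> (0 : R).
  by apply: cvg_geometric; rewrite ger0_norm.
apply/cvgrPdist_le => e /cv; apply: filterS => n.
by rewrite sub0r normrN; apply: le_trans; apply: (le_trans (xc n)); exact: ler_norm.
Qed.

Lemma le_geometric_eq0 (x c : R) : (forall n, `|x| <= c * q ^+ n) -> x = 0.
Proof.
move=> xc; have : (fun=> 0 : R) n @[n --> \oo] --> x.
  by apply: (@le_geometric_cvg _ _ c) => n; rewrite subr0.
by move/cvg_unique; apply => //; exact: cvg_cst.
Qed.

(** The Neumann series is summed pointwise, with [u n] the [n]-th iterate of [L] on [h]. The
    equation thus holds at every point, not merely almost everywhere. *)
Lemma resolvent_exists h : inW0 h ->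
  exists g, inW0 g /\ forall y, g y = h y + L g y.
Proof.
move=> h0; have /andP[q0 q1] := q01; have hW := h0.1.
have q10 : 0 < 1 - q by rewrite subr_gt0.
pose u := fix u n := if n is n.+1 then L (u n) else h.
pose W := nW h.
have W0 : 0 <= W by exact: nW_ge0.
have un n : inW0 (u n) /\ nW (u n) <= W * q ^+ n.
  elim: n => [|n [u0 uq]] /=; first by rewrite expr0 mulr1.
  have [Lu0 nLu] := inW0_intop u0; split => //; apply: (le_trans nLu).
  by rewrite exprS mulrCA ler_wpM2l.
pose s n y := \sum_(i < n) u i y.
have sS n : s n.+1 = fun y => s n y + u n y.
  by apply/funext => y; rewrite /s big_ord_recr.
have s0 n : inW0 (s n).
  elim: n => [|n IH]; last by rewrite sS; apply: inW0D => //; exact: (un n).1.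
  rewrite (_ : s 0%N = fun y => 0 * h y); first exact: inW0Z.
  by apply/funext => y; rewrite /s big_ord0 mul0r.
have sL n y : s n.+1 y = h y + L (s n) y.
  elim: n y => [|n IH] y.
    rewrite /s big_ord1 /= [X in L X](_ : _ = fun y => 0 * h y); last first.
      by apply/funext => z; rewrite big_ord0 mul0r.
    by rewrite intopZ// mul0r addr0.
  rewrite sS IH sS intopD//; [by rewrite addrA|exact: (s0 n).1|exact: (un n).1.1].
pose c := W / (1 - q).
(* The factor [1 - q ^+ p] is the exact geometric sum and lets the induction on [p] close; [sb']
   then drops it to be uniform in [p]. *)
have sb n p : nW (fun y => s (n + p)%N y - s n y) <= c * q ^+ n * (1 - q ^+ p).
  elim: p => [|p IH].
    rewrite expr0 subrr mulr0 [X in nW X](_ : _ = fun y => 0 * h y); last first.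
      by apply/funext => y; rewrite addn0 subrr mul0r.
    by have [_ ->] := wnormZ mw w1 0 hW; rewrite normr0 mul0r.
  rewrite addnS sS [X in nW X](_ : _ = fun y => (s (n + p)%N y - s n y) + u (n + p)%N y).
    have [_] := wnormD mw w1 (inW0B (s0 (n + p)%N) (s0 n)).1 (un (n + p)%N).1.1.
    move=> /le_trans; apply; apply: (le_trans (lerD IH (un _).2)).
    rewrite exprD exprS /c.
    suff : W / (1 - q) * q ^+ n * (1 - q ^+ p) + W * (q ^+ n * q ^+ p) =
           W / (1 - q) * q ^+ n * (1 - q * q ^+ p) by move=> ->.
    by field; rewrite gt_eqF.
  by apply/funext => y; rewrite addrAC.
have c0 : 0 <= c by rewrite divr_ge0// ltW.
have sb' n p : nW (fun y => s (n + p)%N y - s n y) <= c * q ^+ n.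
  apply: (le_trans (sb n p)); apply: ler_piMr.
    by rewrite mulr_ge0// exprn_ge0.
  by have := exprn_ge0 p q0; lra.
(* The term [h] need not be bounded, but all later terms are images under [L] and lie below
   [C * W * q ^+ n]. Hence the series is shifted by one. *)
have cs y : cvgn (fun n => s n y).
  have : cvgn (series (fun n => u n.+1 y)).
    apply: normed_cvg; apply: (@series_le_cvg _ _ (geometric (C * W) q)) => //.
    - by move=> n /=.
    - by move=> n; rewrite /geometric /= mulr_ge0 ?mulr_ge0 ?exprn_ge0.
    - move=> n; rewrite /geometric /= -mulrA.
      apply: (le_trans (normr_intop_le_nW y (un n).1.1)).
      by rewrite ler_wpM2l// (un n).2.
    - by apply: is_cvg_geometric_series; rewrite ger0_norm.
  move=> /cvg_ex[l ul]; apply/cvg_ex; exists (h y + l).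
  rewrite -cvg_shiftS (_ : [sequence s n.+1 y]_n =
      fun n => h y + series (fun n => u n.+1 y) n).
    by apply: cvgD => //; exact: cvg_cst.
  by apply/funext => n /=; rewrite /s big_ord_recl /series /= big_mkord.
pose g y := limn (fun n => s n y).
have gs n : inW (fun y => g y - s n y) /\ nW (fun y => g y - s n y) <= c * q ^+ n.
  have sW p := (inW0B (s0 (n + p)%N) (s0 n)).1.
  apply: (wnorm_lim mw w1 (f := fun p y => s (n + p)%N y - s n y)).
  - by move=> p; case: (sW p).
  - by move=> p; rewrite wnormE// lee_fin.
  - move=> y; apply: cvgB; last exact: cvg_cst.
    rewrite (_ : (fun p => s (n + p)%N y) = fun p => s (p + n)%N y); last first.
      by apply/funext => p; rewrite addnC.
    by rewrite (cvg_shiftn n (fun p => s p y)); exact: cs.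
have gW : inW g.
  rewrite (_ : g = fun y => (g y - s 0%N y) + s 0%N y).
    by have [] := wnormD mw w1 (gs 0%N).1 (s0 0%N).1.
  by apply/funext => y; rewrite subrK.
exists g; split; first split => //.
  (* Partial sums have mean zero, so the mean of [g] equals that of [g - s n], which is at most
     [c * q ^+ n] for every [n]. *)
  apply/inW0P => //; apply: (@le_geometric_eq0 _ c) => n.
  rewrite (_ : Rintegral mu setT g = Rintegral mu setT (fun y => g y - s n y)).
    by apply: le_trans (gs n).2; apply: normr_integral_le_nW => //; exact: (gs n).1.
  have := Rintegral_inWD (gs n).1 (s0 n).1.
  have /(inW0P (s0 n).1) -> := (s0 n).2; rewrite addr0 => <-.
  by congr Rintegral; apply/funext => y; rewrite subrK.
move=> y; apply/cvg_lim => //; rewrite -cvg_shiftS.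
rewrite (_ : [sequence s n.+1 y]_n = fun n => h y + L (s n) y); last first.
  by apply/funext => n /=; rewrite sL.
apply: cvgD; first exact: cvg_cst.
apply: (@le_geometric_cvg _ _ (C * c)) => n.
rewrite -intopB//; last exact: (s0 n).1.
by rewrite -mulrA (le_trans (normr_intop_le_nW y (gs n).1))// ler_wpM2l// (gs n).2.
Qed.

End Resolvent.

(** * Square-integrable kernels *)

Section SquareIntegrable.
Context d (T : measurableType d) (R : realType).
Variable mu : {sigma_finite_measure set T -> \bar R}.
Variables (D : set T).
Hypothesis mD : measurable D.
Hypothesis finD : (mu D < +oo)%E.
Implicit Types f g : T -> R.

(** Squared norms are kept throughout, with the bound of [(a + b) ^+ 2] by [2 * a ^+ 2 + 2 * b ^+ 2]
    in place of Minkowski, so that the final estimate is polynomial arithmetic. *)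
Definition sqint f : \bar R := (\int[mu]_(x in D) (f x ^+ 2)%:E)%E.
Definition inQ f := measurable_fun setT f /\ (sqint f < +oo)%E.
Definition nQ f : R := fine (sqint f).

Lemma sqint_ge0 f : (0 <= sqint f)%E.
Proof. by apply: integral_ge0 => x _; rewrite lee_fin sqr_ge0. Qed.

Lemma nQ_ge0 f : 0 <= nQ f.
Proof. by rewrite fine_ge0// sqint_ge0. Qed.

Lemma sqintE f : inQ f -> sqint f = (nQ f)%:E.
Proof. by move=> [_ f1]; rewrite fineK// ge0_fin_numE// sqint_ge0. Qed.

Lemma sqint_le_inQ f (A : R) : measurable_fun setT f -> (sqint f <= A%:E)%E ->
  inQ f /\ nQ f <= A.
Proof.
move=> mf fA; have f1 : inQ f by split=> //; apply: le_lt_trans fA (ltry _).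
by split=> //; rewrite -lee_fin -sqintE.
Qed.

Lemma measurable_sqr f : measurable_fun setT f -> measurable_fun setT (fun x => f x ^+ 2).
Proof. by move=> mf; apply: measurable_funX. Qed.

Lemma sqintD f g : inQ f -> inQ g ->
  inQ (fun x => f x + g x) /\ nQ (fun x => f x + g x) <= 2 * nQ f + 2 * nQ g.
Proof.
move=> fQ gQ; have [mf _] := fQ; have [mg _] := gQ.
have [mf2 mg2] := (measurable_sqr mf, measurable_sqr mg).
apply: sqint_le_inQ; first exact: measurable_funD.
rewrite EFinD !EFinM -!sqintE// /sqint -!ge0_integralZl_EFin//; last 2 first.
- by move=> x; rewrite sqr_ge0.
- by move=> x; rewrite sqr_ge0.
rewrite -ge0_integralD_EFin//; last 4 first.
- exact: measurable_funM.
- exact: measurable_funM.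
- by move=> x; rewrite mulr_ge0// sqr_ge0.
- by move=> x; rewrite mulr_ge0// sqr_ge0.
apply: ge0_le_integral_EFin => //.
- exact/measurable_sqr/measurable_funD.
- by apply: measurable_funD; exact: measurable_funM.
- by move=> x; rewrite sqr_ge0.
- move=> x; rewrite -subr_ge0 [leRHS](_ : _ = (f x - g x) ^+ 2) ?sqr_ge0//.
  by ring.
Qed.

Lemma sqintZ c f : inQ f ->
  inQ (fun x => c * f x) /\ nQ (fun x => c * f x) = c ^+ 2 * nQ f.
Proof.
move=> fQ; have [mf _] := fQ.
have E : sqint (fun x => c * f x) = (c ^+ 2 * nQ f)%:E.
  rewrite EFinM -sqintE// -ge0_integralZl_EFin//.
  - by apply: eq_integral => x _; rewrite exprMn.
  - exact: measurable_sqr.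
  - by move=> x; rewrite sqr_ge0.
  - by rewrite sqr_ge0.
split; last by rewrite /nQ E.
by split; [exact: measurable_funM|rewrite E ltry].
Qed.

Lemma sqintB f g : inQ f -> inQ g ->
  inQ (fun x => f x - g x) /\ nQ (fun x => f x - g x) <= 2 * nQ f + 2 * nQ g.
Proof.
move=> fQ /(sqintZ (-1)) [gQ ng]; have [] := sqintD fQ gQ.
rewrite ng sqrrN expr1n mul1r.
rewrite (_ : (fun x => f x + -1 * g x) = (fun x => f x - g x))//.
by apply/funext => x; rewrite mulN1r.
Qed.

Lemma sqint_ae f g : measurable_fun setT f -> measurable_fun setT g ->
  {ae mu, forall x, f x = g x} -> sqint f = sqint g.
Proof.
move=> mf mg fg; apply: ge0_ae_eq_integral => //.
- by apply/measurable_EFinP; exact: measurable_funS (measurable_sqr mf).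
- by apply/measurable_EFinP; exact: measurable_funS (measurable_sqr mg).
- by move=> x _; rewrite lee_fin sqr_ge0.
- by move=> x _; rewrite lee_fin sqr_ge0.
- by apply: filterS fg => x + _ => ->.
Qed.

Lemma sqint_bounded f (c : R) : measurable_fun setT f -> (forall x, `|f x| <= c) ->
  inQ f /\ nQ f <= c ^+ 2 * fine (mu D).
Proof.
move=> mf fc; apply: sqint_le_inQ => //.
rewrite EFinM fineK ?ge0_fin_numE// -integral_cst//.
apply: (@ge0_le_integral_EFin _ _ _ mu D (fun x => f x ^+ 2) (cst (c ^+ 2))) => //.
- exact: measurable_sqr.
- by move=> x; rewrite sqr_ge0.
- by move=> x; rewrite -real_normK ?num_real// lerXn2r// nnegrE// (le_trans _ (fc x)).
Qed.

Definition inL2 (k : T -> T -> R) :=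
  [/\ measurable_fun setT (fun p : T * T => k p.1 p.2),
      forall x y, ~ (D x /\ D y) -> k x y = 0 &
      (\int[mu]_x \int[mu]_y (k x y ^+ 2)%:E < +oo)%E].
Definition nL2 (k : T -> T -> R) : R :=
  Num.sqrt (fine (\int[mu]_x \int[mu]_y (k x y ^+ 2)%:E)%E).

Lemma nL2_sqrE k : inL2 k ->
  (\int[mu]_x \int[mu]_y (k x y ^+ 2)%:E = (nL2 k ^+ 2)%:E)%E.
Proof.
move=> [_ _ kfin].
have k0 : (0 <= \int[mu]_x \int[mu]_y (k x y ^+ 2)%:E)%E.
  by apply: integral_ge0 => x _; apply: integral_ge0 => y _; rewrite lee_fin sqr_ge0.
by rewrite sqr_sqrtr ?fine_ge0// fineK// ge0_fin_numE.
Qed.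

Lemma tonelli_sqr k : inL2 k ->
  (\int[mu]_y \int[mu]_x (k x y ^+ 2)%:E = (nL2 k ^+ 2)%:E)%E.
Proof.
move=> kL; rewrite -nL2_sqrE// (@tonelli _ _ _ mu (fun x y => k x y ^+ 2))//.
- by case: kL => mk _ _; exact: measurable_funX.
- by move=> x y; rewrite sqr_ge0.
Qed.

Lemma measurable_sqr_sections k : inL2 k ->
  measurable_fun setT ((fun y => \int[mu]_x (k x y ^+ 2)%:E)%E : T -> \bar R).
Proof.
case=> mk _ _; apply: (@measurable_integral1 _ _ _ mu (fun x y => k x y ^+ 2)).
- exact: measurable_funX.
- by move=> x y; rewrite sqr_ge0.
Qed.

(** By Tonelli almost every section of [k] is square integrable, and Cauchy-Schwarz applies there.
    Integrability is part of the conclusion because linearity of the operator, in the kernel or in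
    the function, is legitimate only at such points. *)
Lemma intopL2_pointwise k f : inL2 k -> inQ f ->
  {ae mu, forall y, mu.-integrable setT (EFin \o (fun x => k x y * f x)) /\
    ((intop mu k f y ^+ 2)%:E <= (nQ f)%:E * \int[mu]_x (k x y ^+ 2)%:E)%E}.
Proof.
move=> kL fQ; have [mk kD _] := kL; have [mf _] := fQ.
have k0 y : (0 <= \int[mu]_x (k x y ^+ 2)%:E)%E.
  by apply: integral_ge0 => x _; rewrite lee_fin sqr_ge0.
have : mu.-integrable setT (fun y => \int[mu]_x (k x y ^+ 2)%:E)%E.
  apply/integrableP; split; first exact: measurable_sqr_sections.
  by under eq_integral do rewrite gee0_abs//; rewrite tonelli_sqr// ltry.
move=> /(integrable_ae measurableT); apply: filterS => y /(_ I) /fineK Ay.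
set A := fine _ in Ay; have A0 : 0 <= A by rewrite fine_ge0.
(* [f] is square integrable on [D] only; cutting it off outside [D] leaves the product with [k]
   unchanged. *)
have mf' : measurable_fun setT (f \_ D).
  by apply/(measurable_restrict _ mD) => //; rewrite setTI; exact: measurable_funS mf.
have mky := measurable_section1 y mk.
have kf x : k x y * f x = k x y * (f \_ D) x.
  by rewrite patchE; case: ifPn => // /negP xD; rewrite kD ?mul0r// => -[/mem_set].
have := @cauchy_schwarz_integral _ _ _ mu (k^~ y) (f \_ D) A (nQ f) mky mf' A0 (nQ_ge0 f).
rewrite -Ay => /(_ (lexx _)) /(_ _)/wrap[].
  rewrite -sqintE// /sqint [leRHS]integral_mkcond.
  apply: eq_lee; apply: eq_integral => x _; rewrite !patchE.
  by case: ifPn => // _; rewrite expr0n.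
move=> CS; have CS' : (\int[mu]_x `|k x y * f x|%:E <= (Num.sqrt (A * nQ f))%:E)%E.
  by under eq_integral do rewrite kf.
split.
  apply/integrableP; split; first exact/measurable_EFinP/measurable_funM.
  by apply: le_lt_trans CS' (ltry _).
rewrite -EFinM lee_fin -real_normK ?num_real//.
rewrite -[leRHS]sqr_sqrtr ?mulr_ge0 ?nQ_ge0// mulrC lerXn2r ?nnegrE ?sqrtr_ge0//.
rewrite -lee_fin; apply: le_trans CS'; apply: (le_trans (normr_intop_le _ _ _ _)) => //.
by apply: eq_lee; apply: eq_integral => x _; rewrite normrM.
Qed.

Lemma intopL2_sqr_le k f : inL2 k -> inQ f ->
  (\int[mu]_y (intop mu k f y ^+ 2)%:E <= (nL2 k ^+ 2 * nQ f)%:E)%E.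
Proof.
move=> kL fQ; have [mk kD _] := kL; have [mf _] := fQ.
have k0 y : (0 <= \int[mu]_x (k x y ^+ 2)%:E)%E.
  by apply: integral_ge0 => x _; rewrite lee_fin sqr_ge0.
rewrite mulrC EFinM -tonelli_sqr// -ge0_integralZl//; last 2 first.
- exact: measurable_sqr_sections.
- by rewrite lee_fin nQ_ge0.
apply: ae_ge0_le_integral => //.
- by move=> y _; rewrite lee_fin sqr_ge0.
- by apply/measurable_EFinP/measurable_sqr; exact: measurable_intop.
- by move=> y _; rewrite mule_ge0// lee_fin nQ_ge0.
- by apply: measurable_funeM; exact: measurable_sqr_sections.
- by apply: filterS (intopL2_pointwise kL fQ) => y [].
Qed.

Lemma intopL2_inQ k f : inL2 k -> inQ f ->
  inQ (intop mu k f) /\ nQ (intop mu k f) <= nL2 k ^+ 2 * nQ f.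
Proof.
move=> kL fQ; have [mk kD _] := kL; have [mf _] := fQ.
have mkf := measurable_intop mu mk mf.
apply: sqint_le_inQ => //; apply: le_trans (intopL2_sqr_le kL fQ).
apply: ge0_subset_integral => //; first exact/measurable_EFinP/measurable_sqr.
by move=> y _; rewrite lee_fin sqr_ge0.
Qed.

(** The image vanishes outside [D], where the weight is at most [M]. Cauchy-Schwarz against the
    indicator of [D] then trades the [L1] norm for the [L2] norm, at the price of the measure of
    [D]. *)
Lemma intopL2_inW (w : T -> R) (M : R) k f :
  measurable_fun setT w -> (forall x, 1 <= w x) -> 0 <= M -> (forall x, D x -> w x <= M) ->
  inL2 k -> inQ f ->
  inW mu w (intop mu k f) /\
  nW mu w (intop mu k f) ^+ 2 <= M ^+ 2 * fine (mu D) * (nL2 k ^+ 2 * nQ f).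
Proof.
move=> mw w1 M0 wM kL fQ; have [mk kD _] := kL; have [mf _] := fQ.
have mkf := measurable_intop mu mk mf.
pose m := fine (mu D); have m0 : 0 <= m by rewrite fine_ge0.
have S0 : 0 <= nL2 k ^+ 2 * nQ f by rewrite mulr_ge0 ?nQ_ge0// sqr_ge0.
have m1 : measurable_fun setT (\1_D : T -> R) by exact: measurable_indic.
suff H : (wnorm mu w (intop mu k f) <= (M * Num.sqrt (m * (nL2 k ^+ 2 * nQ f)))%:E)%E.
  have [kW nk] := wnorm_le_inW w1 mkf H; split => //.
  rewrite -mulrA -/m -[m * _]sqr_sqrtr; last exact: mulr_ge0.
  by rewrite -exprMn lerXn2r ?nnegrE ?nW_ge0// mulr_ge0.
have := @cauchy_schwarz_integral _ _ _ mu \1_D (intop mu k f) m _ m1 mkf m0 S0.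
move=> /(_ _ (intopL2_sqr_le kL fQ))/wrap[].
  have -> : m%:E = (\int[mu]_x (\1_D x)%:E)%E.
    by rewrite integral_indic// setIT /m fineK// ge0_fin_numE.
  apply: eq_lee; apply: eq_integral => x _; rewrite indicE.
  by case: (_ \in _); rewrite ?expr1n ?expr0n.
move=> CS; rewrite EFinM; apply: le_trans (lee_wpmul2l _ CS); last by rewrite lee_fin.
rewrite -ge0_integralZl_EFin//; last first.
  by apply: measurableT_comp => //; exact: measurable_funM.
apply: ge0_le_integral_EFin => //.
- exact: measurable_wnorm_integrand.
- by apply: measurable_funM => //; apply: measurableT_comp => //; exact: measurable_funM.
- by move=> x; rewrite mulr_ge0// (le_trans _ (w1 x)).
- move=> y; rewrite indicE; case: (boolP (y \in D)) => yD.
    by rewrite mul1r ler_wpM2r// wM//; exact: set_mem.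
  suff -> : intop mu k f y = 0 by rewrite normr0 !mulr0 normr0 mulr0.
  rewrite /intop (_ : (fun x => _) = cst 0) ?Rintegral0//.
    by rewrite /Rintegral integral0.
  by apply/funext => x; rewrite kD ?mul0r// => -[_ /mem_set]; exact/negP.
Qed.

End SquareIntegrable.

(** * Linear response for a contracting kernel *)

Lemma sqr_le_of_leD (R : realDomainType) (x a b : R) :
  0 <= x -> x <= a + b -> x ^+ 2 <= 2 * a ^+ 2 + 2 * b ^+ 2.
Proof.
move=> x0 xab; apply: (@le_trans _ _ ((a + b) ^+ 2)).
  by rewrite lerXn2r// nnegrE// (le_trans x0).
rewrite -subr_ge0 [leRHS](_ : _ = (a - b) ^+ 2) ?sqr_ge0//.
by ring.
Qed.

(** This closes the circular estimate: [a], [b], [c] stand for the squared norms of the increment,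
    of the perturbed density and of [f0]. Substituting [b] gives [a <= 2 * X * a + 2 * X * c], and
    the first term is at most [a / 2]. *)
Lemma absorb_quarter (R : realFieldType) (X a b c : R) :
  0 <= a -> 0 <= c -> 4 * X <= 1 -> 0 <= X -> a <= X * b -> b <= 2 * a + 2 * c ->
  a <= 4 * X * c /\ b <= 4 * c.
Proof.
move=> a0 c0 X4 X0 ab bc.
have h1 : X * b <= X * (2 * a + 2 * c) by rewrite ler_wpM2l.
have h2 : 4 * X * a <= 1 * a by rewrite ler_wpM2r.
have h3 : 4 * X * c <= 1 * c by rewrite ler_wpM2r.
by split; lra.
Qed.

(* The estimates behind [response_bound], with [q] for squared [L2(D)] norms and
   [p] for weighted [L1] norms: [v] is the increment of the density, [h] the
   defect in [v = L v + h], [w] the defect for the remainder [u]. *)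
Lemma response_arith (R : realFieldType)
    (A C m B K S e qf qf0 qv qLv qh qKf qRf ph pv pKf pRf pw pKv pu : R) :
  let c1 := 4 + 4 * A * C ^+ 2 * m * B ^+ 2 in
  0 <= A -> 0 <= m -> 0 <= B -> 0 <= K -> 0 <= S ->
  0 <= qf0 -> 0 <= qv -> 0 <= qf -> 0 <= ph -> 0 <= pv -> 0 <= pw -> 0 <= pu ->
  pKf ^+ 2 <= A * (K * qf) -> pRf ^+ 2 <= A * (S * qf) ->
  qKf <= K * qf -> qRf <= S * qf ->
  ph <= `|e| * pKf + pRf -> qh <= 2 * (e ^+ 2 * qKf) + 2 * qRf ->
  pv <= B * ph -> qLv <= (C * pv) ^+ 2 * m ->
  qv <= 2 * qLv + 2 * qh -> qf <= 2 * qv + 2 * qf0 ->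
  4 * c1 * (e ^+ 2 * K + S) <= 1 ->
  pKv ^+ 2 <= A * (K * qv) -> pw <= pKv + `|e^-1| * pRf -> pu <= B * pw ->
  pu ^+ 2 <= B ^+ 2 * (2 * (A * K * (4 * c1 * qf0) + A * (4 * qf0))) *
    ((e ^+ 2 * K + S) + S * e^-1 ^+ 2).
Proof.
move=> c1 A0 m0 B0 K0 S0 qf00 qv0 qf_0 ph0 pv0 pw0 pu0.
move=> hKf hRf gKf gRf hph hqh hpv hLv hqv hqf se hKv hpw hpu.
have sq0 (x : R) : 0 <= x ^+ 2 by exact: sqr_ge0.
have c10 : 0 <= c1.
  apply: addr_ge0 => //; apply: mulr_ge0 (sq0 _); apply: mulr_ge0 m0.
  by apply: mulr_ge0 (sq0 _); exact: mulr_ge0.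
set s := e ^+ 2 * K + S in se *; have s0 : 0 <= s by rewrite addr_ge0// mulr_ge0.
have ph2 : ph ^+ 2 <= 2 * A * s * qf.
  apply: (le_trans (sqr_le_of_leD ph0 hph)); rewrite exprMn real_normK ?num_real//.
  rewrite [leRHS](_ : _ = 2 * (e ^+ 2 * (A * (K * qf))) + 2 * (A * (S * qf))).
    by rewrite lerD// ler_wpM2l// ler_wpM2l.
  by rewrite /s; ring.
have qh2 : qh <= 2 * s * qf.
  apply: (le_trans hqh).
  rewrite [leRHS](_ : _ = 2 * (e ^+ 2 * (K * qf)) + 2 * (S * qf)).
    by rewrite lerD// ler_wpM2l// ler_wpM2l.
  by rewrite /s; ring.
have pv2 : pv ^+ 2 <= B ^+ 2 * (2 * A * s * qf).
  apply: (@le_trans _ _ ((B * ph) ^+ 2)).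
    by rewrite lerXn2r// nnegrE mulr_ge0.
  by rewrite exprMn ler_wpM2l.
(* Here [c1] originates: the summand with [C], [m] and [B] comes from [L v] through the resolvent
   and the smoothing of [L], the summand 4 from the defect itself. *)
have qv1 : qv <= c1 * s * qf.
  apply: (le_trans hqv); rewrite [leRHS](_ : _ =
    2 * (C ^+ 2 * (B ^+ 2 * (2 * A * s * qf)) * m) + 2 * (2 * s * qf)).
    rewrite lerD// ler_wpM2l//; apply: (le_trans hLv).
    by rewrite exprMn ler_wpM2r// ler_wpM2l.
  by rewrite /c1; ring.
have cs4 : 4 * (c1 * s) <= 1 by rewrite mulrA.
have [qv2 qf4] := absorb_quarter qv0 qf00 cs4 (mulr_ge0 c10 s0) qv1 hqf.
apply: (@le_trans _ _ ((B * pw) ^+ 2)).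
  by rewrite lerXn2r// nnegrE mulr_ge0.
rewrite exprMn -mulrA ler_wpM2l//.
apply: (le_trans (sqr_le_of_leD pw0 hpw)); rewrite exprMn real_normK ?num_real//.
set t := S * e^-1 ^+ 2; have t0 : 0 <= t by rewrite mulr_ge0.
have H1 : pKv ^+ 2 <= A * K * (4 * c1 * qf0) * s.
  rewrite [leRHS](_ : _ = A * (K * (4 * (c1 * s) * qf0))); last by ring.
  by apply: (le_trans hKv); rewrite ler_wpM2l// ler_wpM2l.
have H2 : e^-1 ^+ 2 * pRf ^+ 2 <= A * (4 * qf0) * t.
  apply: (le_trans (ler_wpM2l (sq0 _) hRf)).
  rewrite [leLHS](_ : _ = A * t * qf); last by rewrite /t; ring.
  rewrite [leRHS](_ : _ = A * t * (4 * qf0)); last by ring.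
  by rewrite ler_wpM2l// mulr_ge0.
(* Nonnegative cross terms complete [X * s + Y * t] to [(X + Y) * (s + t)], which separates a
   constant independent of [e] from the vanishing factor. *)
have X0 : 0 <= A * K * (4 * c1 * qf0) * t.
  apply: mulr_ge0 t0; apply: mulr_ge0 (mulr_ge0 A0 K0) _.
  by apply: mulr_ge0 qf00; exact: mulr_ge0.
have Y0 : 0 <= A * (4 * qf0) * s.
  by apply: mulr_ge0 s0; apply: mulr_ge0 A0 _; exact: mulr_ge0.
move: H1 H2 X0 Y0; move: (A * K * (4 * c1 * qf0)) (A * (4 * qf0)) (pKv ^+ 2) (e^-1 ^+ 2 * pRf ^+ 2).
by clear -s t; move=> X Y a b; lra.
Qed.

Section LinearResponse.
Context d (T : measurableType d) (R : realType).
Variable mu : {sigma_finite_measure set T -> \bar R}.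
Variables (w : T -> R) (k : T -> T -> R) (C q : R) (D : set T) (M : R).
Hypothesis mw : measurable_fun setT w.
Hypothesis w1 : forall x, 1 <= w x.
Hypothesis mk : measurable_fun setT (fun p : T * T => k p.1 p.2).
Hypothesis kC : forall x y, 0 <= k x y <= C.
Hypothesis q01 : 0 <= q < 1.
Hypothesis contr : forall g, inW0 mu w g ->
  (wnorm mu w (intop mu k g) <= q%:E * wnorm mu w g)%E.
Hypothesis mD : measurable D.
Hypothesis finD : (mu D < +oo)%E.
Hypothesis M0 : 0 <= M.
Hypothesis wM : forall x, D x -> w x <= M.

Variables (db : R) (kd : T -> T -> R) (r : R -> T -> T -> R).
Hypothesis db0 : 0 < db.
Hypothesis kdL2 : inL2 mu D kd.
Hypothesis rL2 : forall e, 0 <= e < db -> inL2 mu D (r e).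
Hypothesis r0 : r 0 = fun _ _ => 0.
Hypothesis r_o : nL2 mu (r e) / e @[e --> 0^'+] --> 0.
Hypothesis pres : forall e, 0 <= e < db -> forall g, inW mu w g ->
  (\int[mu]_x (intop mu (fun x y => k x y + e * kd x y + r e x y) g x)%:E =
   \int[mu]_x (g x)%:E)%E.

Local Notation inW := (inW mu w).
Local Notation inW0 := (inW0 mu w).
Local Notation nW := (nW mu w).
Local Notation inQ := (inQ mu D).
Local Notation nQ := (nQ mu D).
Local Notation nL2 := (nL2 mu).
Local Notation L := (intop mu k).
Local Notation Ld := (intop mu kd).
Local Notation Rem e := (intop mu (r e)).
Implicit Types f g h : T -> R.

Lemma pres0 g : inW g -> (\int[mu]_x (L g x)%:E = \int[mu]_x (g x)%:E)%E.
Proof.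
move=> gW; have h0 : 0 <= (0 : R) < db by rewrite lexx.
apply: etrans (pres h0 gW); apply: eq_integral => y _; congr (_%:E).
by apply: eq_Rintegral => x _; rewrite r0 mul0r !addr0.
Qed.

Lemma intop_perturbed e f : 0 <= e < db -> inW f -> inQ f ->
  {ae mu, forall y, intop mu (fun x y => k x y + e * kd x y + r e x y) f y =
    L f y + e * Ld f y + Rem e f y}.
Proof.
move=> he fW fQ.
apply: filterS2 (intopL2_pointwise mD kdL2 fQ) (intopL2_pointwise mD (rL2 he) fQ).
move=> y [i1 _] [i2 _]; have ik := integrable_inW_kernel mw w1 mk kC y fW.
have i1e : mu.-integrable setT (EFin \o (fun x => e * (kd x y * f x))).
  rewrite (_ : _ \o _ = fun x => e%:E * (kd x y * f x)%:E)%E; first exact: integrableZl.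
  by apply/funext => x /=; rewrite EFinM.
rewrite /intop -RintegralZl// -RintegralD// -RintegralD//; last first.
  rewrite (_ : _ \o _ = fun x => (k x y * f x)%:E + (e * (kd x y * f x))%:E)%E.
    exact: integrableD.
  by apply/funext => x /=; rewrite EFinD.
by apply: eq_Rintegral => x _; rewrite !mulrDl mulrA.
Qed.

Lemma intopL2B kk f g : inL2 mu D kk -> inQ f -> inQ g ->
  {ae mu, forall y, intop mu kk (fun x => f x - g x) y = intop mu kk f y - intop mu kk g y}.
Proof.
move=> kL fQ gQ.
apply: filterS2 (intopL2_pointwise mD kL fQ) (intopL2_pointwise mD kL gQ).
move=> y [i1 _] [i2 _]; rewrite /intop -RintegralB//.
by apply: eq_Rintegral => x _; rewrite mulrBr.
Qed.

Let A := M ^+ 2 * fine (mu D).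
Let A0 : 0 <= A. Proof. by rewrite mulr_ge0 ?sqr_ge0 ?fine_ge0. Qed.

Let inWL2 kk f : inL2 mu D kk -> inQ f ->
  inW (intop mu kk f) /\ nW (intop mu kk f) ^+ 2 <= A * (nL2 kk ^+ 2 * nQ f).
Proof. by move=> kL fQ; exact: (intopL2_inW mD finD mw w1 M0 wM kL fQ). Qed.

Lemma intop_inQ f : inW f ->
  inQ (L f) /\ nQ (L f) <= (C * nW f) ^+ 2 * fine (mu D).
Proof.
move=> fW; have [mf _] := fW; apply: sqint_bounded => //.
  exact: measurable_intop.
by move=> y; exact: (normr_intop_le_nW mw w1 mk kC).
Qed.

Lemma Rintegral_ae f g : measurable_fun setT f -> measurable_fun setT g ->
  {ae mu, forall y, f y = g y} -> Rintegral mu setT f = Rintegral mu setT g.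
Proof.
move=> mf mg fg; congr fine; apply: ae_eq_integral => //; try exact/measurable_EFinP.
by apply: filterS fg => x + _ => ->.
Qed.

Variable f0 : T -> R.
Hypothesis f0W : inW f0.
Hypothesis f0Q : inQ f0.
Hypothesis f01 : (\int[mu]_x (f0 x)%:E = 1)%E.
Hypothesis f0E : {ae mu, forall y, L f0 y = f0 y}.

(** Integrating the perturbed operator applied to [f0] gives [1 = 1 + e * I + J], with [J] the mass
    of the remainder term. So [I = - J / e], which tends to 0 by the assumption on [r], while [I]
    does not depend on [e]. *)
Lemma intop_derivative_mean0 : inW0 (Ld f0).
Proof.
have [LW _] := inWL2 kdL2 f0Q; split => //; apply/(inW0P mw w1 LW).
set I := Rintegral mu setT (Ld f0).
pose c := Num.sqrt (A * nQ f0).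
have Ie e : 0 < e < db -> `|I| <= c * (nL2 (r e) / e).
  move=> /andP[e0 eb]; have he : 0 <= e < db by rewrite ltW.
  have [RW nR] := inWL2 (rL2 he) f0Q; have [eLW _] := wnormZ mw w1 e LW.
  have [mf _] := f0W; have mLf := measurable_intop mu mk mf.
  have LfW : inW (L f0) by split => //; rewrite (wnorm_ae mw w1 mLf mf f0E) f0W.2.
  have [SW _] := wnormD mw w1 LfW eLW.
  have [SW' _] := wnormD mw w1 SW RW.
  have mp : measurable_fun setT (intop mu (fun x y => k x y + e * kd x y + r e x y) f0).
    apply: measurable_intop => //; have [m1 _ _] := kdL2; have [m2 _ _] := rL2 he.
    by do 2 (apply: measurable_funD => //); exact: measurable_funM.
  have := Rintegral_ae mp SW'.1 (intop_perturbed he f0W f0Q).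
  rewrite (Rintegral_inWD mw w1 SW RW) (Rintegral_inWD mw w1 LfW eLW).
  rewrite (Rintegral_inWZ mw w1 e LW) -/I.
  rewrite [LHS](_ : _ = 1); last by rewrite /Rintegral pres// f01.
  rewrite (Rintegral_ae mLf mf f0E) [Rintegral mu setT f0](_ : _ = 1); last first.
    by rewrite /Rintegral f01.
  set J := Rintegral mu setT (Rem e f0) => E.
  have J1 : `|J| <= c * nL2 (r e).
    apply: (le_trans (normr_integral_le_nW mw w1 RW)).
    have nn0 : 0 <= nL2 (r e) by exact: sqrtr_ge0.
    rewrite -(@ler_pXn2r _ 2)// ?nnegrE ?(nW_ge0 _ w1) ?mulr_ge0 ?sqrtr_ge0//.
    rewrite exprMn sqr_sqrtr; last by rewrite mulr_ge0// nQ_ge0.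
    by apply: (le_trans nR); rewrite mulrA mulrAC.
  rewrite mulrA ler_pdivlMr// (_ : I = - J / e); last first.
    by rewrite -[LHS](mulfK (lt0r_neq0 e0)); congr (_ / _); lra.
  by rewrite normrM normrN normfV (gtr0_norm e0) divfK ?lt0r_neq0.
have cI : c * (nL2 (r e) / e) @[e --> 0^'+] --> 0.
  by rewrite -[X in _ --> X](mulr0 c); exact: cvgMr.
apply/normr0_eq0/eqP; rewrite eq_le normr_ge0 andbT.
rewrite -(cvg_lim _ cI)//; apply: limr_ge; first by apply/cvg_ex; exists 0.
by near=> e; apply: Ie; apply/andP; split; near: e; [exact: nbhs_right_gt|exact: nbhs_right_lt].
Unshelve. all: by end_near. Qed.

Variable g : T -> R.
Hypothesis g0 : inW0 g.
Hypothesis gE : forall y, g y = Ld f0 y + L g y.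

(** These are the constants of [response_arith] for [B := (1 - q)^-1], the resolvent bound,
    [K := nL2 kd ^+ 2] and [S := nL2 (r e) ^+ 2]. Up to a factor 2, [sigma e] bounds the squared
    size of the whole perturbation. *)
Let c1 := 4 + 4 * A * C ^+ 2 * fine (mu D) * (1 - q)^-1 ^+ 2.
Let c2 := (1 - q)^-1 ^+ 2 * (2 * (A * nL2 kd ^+ 2 * (4 * c1 * nQ f0) + A * (4 * nQ f0))).
Let sigma e := e ^+ 2 * nL2 kd ^+ 2 + nL2 (r e) ^+ 2.

(** The resolvent bound is used twice. For [v] it is circular, since the defect [h] contains [f];
    this is where smallness of [sigma e] enters. For [u] the defect only involves quantities already
    controlled. *)
Lemma response_bound e f : 0 < e < db -> 4 * c1 * sigma e <= 1 ->
  inW f -> inQ f -> (\int[mu]_x (f x)%:E = 1)%E ->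
  {ae mu, forall y, intop mu (fun x y => k x y + e * kd x y + r e x y) f y = f y} ->
  let u := fun y => (f y - f0 y) / e - g y in
  inW u /\ nW u ^+ 2 <= c2 * (sigma e + (nL2 (r e) / e) ^+ 2).
Proof.
move=> /andP[e0 eb] se fW fQ f1 fE u.
have he : 0 <= e < db by rewrite ltW.
have [q0 q1] := andP q01.
have iq : 0 < (1 - q)^-1 by rewrite invr_gt0 subr_gt0.
pose v y := f y - f0 y.
have [vW _] := wnormB mw w1 fW f0W.
have [vQ _] := sqintB mD fQ f0Q.
have v0 : inW0 v.
  split => //; apply/(inW0P mw w1 vW).
  rewrite /Rintegral; have := Rintegral_inWD mw w1 vW f0W.
  rewrite (_ : (fun x => v x + f0 x) = f); last by apply/funext => x; rewrite subrK.
  by rewrite /Rintegral f1 f01 /= => E; lra.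
pose h y := e * Ld f y + Rem e f y.
have [KfW nKf] := inWL2 kdL2 fQ; have [RfW nRf] := inWL2 (rL2 he) fQ.
have [KfQ nQKf] := intopL2_inQ mD kdL2 fQ; have [RfQ nQRf] := intopL2_inQ mD (rL2 he) fQ.
have [eKW neK] := wnormZ mw w1 e KfW; have [eKQ nQeK] := sqintZ mD e KfQ.
have [hW nh] := wnormD mw w1 eKW RfW; have [hQ nQh] := sqintD mD eKQ RfQ.
have vE : {ae mu, forall y, v y = L v y + h y}.
  apply: (filterS3 _ _ fE f0E (intop_perturbed he fW fQ)) => y fy f0y py.
  by rewrite /v (intopB mw w1 mk kC y fW f0W) /h -{1}fy py -{1}f0y; ring.
have nv := resolvent_bound mw w1 mk q01 pres0 contr v0 hW vE.
have [LvQ nLv] := intop_inQ vW.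
have nQv : nQ v <= 2 * nQ (L v) + 2 * nQ h.
  have [sQ ns] := sqintD mD LvQ hQ.
  suff -> : nQ v = nQ (fun y => L v y + h y) by [].
  by congr fine; apply: sqint_ae => //; [case: vQ|case: sQ].
have nf : nQ f <= 2 * nQ v + 2 * nQ f0.
  have [_ +] := sqintD mD vQ f0Q.
  by rewrite (_ : (fun x => v x + f0 x) = f)//; apply/funext => x; rewrite subrK.
have [KvW nKv] := inWL2 kdL2 vQ.
have [eRW neR] := wnormZ mw w1 e^-1 RfW.
have [sW ns] := wnormD mw w1 KvW eRW.
have ev0 := inW0Z mw w1 e^-1 v0.
have u0 : inW0 u.
  have := inW0B mw w1 ev0 g0; congr inW0.
  by apply/funext => y; rewrite /u /v mulrC.
split; first by case: u0.
(* Divide the equation of [v] by [e] and subtract that of [g]: the term [Ld f - Ld f0] becomes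
   [Ld v]. *)
have uE : {ae mu, forall y, u y = L u y + (Ld v y + e^-1 * Rem e f y)}.
  apply: filterS2 vE (intopL2B kdL2 fQ f0Q) => y vy Kv.
  rewrite (_ : L u y = e^-1 * L v y - L g y); last first.
    rewrite -(intopZ mw w1 mk kC e^-1 y vW) -(intopB mw w1 mk kC y ev0.1 g0.1).
    by congr intop; apply/funext => z; rewrite /u /v mulrC.
  rewrite /u /= (gE y) -/(v y) vy Kv /h; field; exact: lt0r_neq0.
have nu := resolvent_bound mw w1 mk q01 pres0 contr u0 sW uE.
rewrite /c2 /c1 /sigma exprMn.
have m0 : 0 <= fine (mu D) by rewrite fine_ge0.
rewrite neK in nh; rewrite neR in ns; rewrite nQeK in nQh.
exact: (response_arith A0 m0 (ltW iq) (sqr_ge0 _) (sqr_ge0 _) (nQ_ge0 mu D f0)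
  (nQ_ge0 mu D v) (nQ_ge0 mu D f) (nW_ge0 mu w1 h) (nW_ge0 mu w1 v) (nW_ge0 mu w1 _)
  (nW_ge0 mu w1 u) nKf nRf nQKf nQRf nh nQh nv nLv nQv nf se nKv ns nu).
Qed.

Lemma response_cvg (f : R -> T -> R) :
  (\forall e \near 0^'+, inW (f e) /\ inQ (f e) /\ (\int[mu]_x (f e x)%:E = 1)%E /\
    {ae mu, forall y,
      intop mu (fun x y => k x y + e * kd x y + r e x y) (f e) y = f e y}) ->
  (fun e => (\int[mu]_y `|(f e y - f0 y) / e - g y|%:E)%E) @ 0^'+ --> 0%E.
Proof.
move=> fP.
pose t e := nL2 (r e) / e.
have cid : e @[e --> 0^'+] --> (0 : R) by apply: cvg_at_right_filter; exact: cvg_id.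
have ct2 : t e ^+ 2 @[e --> 0^'+] --> (0 : R).
  rewrite -[X in _ --> X](mulr0 0); under eq_fun do rewrite expr2.
  exact: cvgM r_o r_o.
have ce2 : e ^+ 2 @[e --> 0^'+] --> (0 : R).
  rewrite -[X in _ --> X](mulr0 0); under eq_fun do rewrite expr2.
  exact: cvgM.
(* This is [sigma e] with [nL2 (r e)] rewritten as [e * t e], so the single limit [r_o] also shows
   that the remainder itself vanishes. *)
have cs' : e ^+ 2 * nL2 kd ^+ 2 + e ^+ 2 * t e ^+ 2 @[e --> 0^'+] --> (0 : R).
  rewrite [X in _ --> X](_ : _ = 0 * nL2 kd ^+ 2 + 0 * 0); last by rewrite !mul0r addr0.
  have h1 : e ^+ 2 * nL2 kd ^+ 2 @[e --> 0^'+] --> 0 * nL2 kd ^+ 2.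
    by apply: (cvgM ce2); exact: cvg_cst.
  exact: (cvgD h1 (cvgM ce2 ct2)).
have cs : sigma e @[e --> 0^'+] --> (0 : R).
  apply: cvg_trans cs'; apply: near_eq_cvg.
  near=> e; have e0 : 0 < e by near: e; exact: nbhs_right_gt.
  rewrite /sigma [X in _ = _ + X](_ : _ = e ^+ 2 * t e ^+ 2)//.
  by rewrite -exprMn /t mulrC divfK// gt_eqF.
have cb : Num.sqrt (c2 * (sigma e + t e ^+ 2)) @[e --> 0^'+] --> (0 : R).
  rewrite -[X in _ --> X](@sqrtr0 R); apply: continuous_cvg; first exact: sqrt_continuous.
  rewrite [X in _ --> X](_ : _ = c2 * (0 + 0)); last by rewrite addr0 mulr0.
  by apply: cvgMr; exact: (cvgD cs ct2).
have ce1 : 4 * c1 * sigma e @[e --> 0^'+] --> (0 : R).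
  by rewrite -[X in _ --> X](mulr0 (4 * c1)); exact: cvgMr.
apply: (squeeze_cvge (f := fun=> 0%E)
  (h := fun e => (Num.sqrt (c2 * (sigma e + t e ^+ 2)))%:E)).
- near=> e; apply/andP; split; first exact: integral_ge0.
  have e0 : 0 < e by near: e; exact: nbhs_right_gt.
  have eb : e < db by near: e; exact: nbhs_right_lt.
  have se : 4 * c1 * sigma e <= 1.
    by near: e; apply: (cvgr_le _ ce1); exact: ltr01.
  have [fW [fQ [f1 fE]]] : inW (f e) /\ inQ (f e) /\ (\int[mu]_x (f e x)%:E = 1)%E /\
    {ae mu, forall y,
      intop mu (fun x y => k x y + e * kd x y + r e x y) (f e) y = f e y} by near: e.
  have e0b : 0 < e < db by rewrite e0.
  have [uW nu] := response_bound e0b se fW fQ f1 fE.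
  apply: (le_trans (L1norm_le_wnorm mu mw w1 uW.1)).
  rewrite wnormE// lee_fin -[leLHS]ger0_norm ?nW_ge0// -sqrtr_sqr.
  by rewrite ler_wsqrtr.
- exact: cvg_cst.
- by apply: cvg_EFin; [exact: nearW|exact: cb].
Unshelve. all: by end_near. Qed.

End LinearResponse.

(** * Lebesgue measure on R^d *)

Section EuclideanMeasure.
Context (R : realType) (d : nat).
Local Notation V := ('rV[R]_d).
Local Notation Rd := (Rd R d).

Definition box (a b : V) : set V := [set v : V | forall i, a ord0 i < v ord0 i < b ord0 i].

Lemma measurable_box a b : measurable (box a b : set Rd).
Proof. by apply: sub_gen_smallest; exists a, b. Qed.

Lemma nbhs_rat_box (x : V) (e : R) : 0 < e -> exists a b : 'rV[rat]_d,
  box (map_mx ratr a) (map_mx ratr b) x /\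
  box (map_mx ratr a) (map_mx ratr b) `<=` ball x e.
Proof.
move=> e0.
have H (i : 'I_d) : exists ab : rat * rat,
    x ord0 i - e < ratr ab.1 < x ord0 i /\ x ord0 i < ratr ab.2 < x ord0 i + e.
  have h1 : x ord0 i - e < x ord0 i by rewrite ltrBlDr ltrDl.
  have h2 : x ord0 i < x ord0 i + e by rewrite ltrDl.
  have [a ha] := rat_in_itvoo h1; have [b hb] := rat_in_itvoo h2.
  by exists (a, b); move: ha hb; rewrite !in_itv.
have /choice[ab Hab] := H.
exists (\row_i (ab i).1), (\row_i (ab i).2); split.
  by move=> i; rewrite !mxE; have [/andP[_ ->] /andP[->]] := Hab i.
move=> y yab; split=> // i j; rewrite ord1.
have := yab j; rewrite !mxE => /andP[h1 h2].
have [/andP[h3 _] /andP[_ h4]] := Hab j.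
rewrite /ball/= ltr_norml; apply/andP; split.
  by rewrite ltrBrDr addrC ltrBlDr (lt_trans h2)//.
by rewrite ltrBlDr -ltrBlDl (lt_trans h3).
Qed.

(** Boxes with rational corners form a countable base, and their products are measurable rectangles.
    This links the topology to the sigma-algebra generated by boxes, and yields joint measurability
    of a continuous kernel. *)
Lemma open_prod_measurable (U : set (V * V)) : open U -> measurable (U : set (Rd * Rd)).
Proof.
move=> oU.
pose B (p : ('rV[rat]_d * 'rV[rat]_d) * ('rV[rat]_d * 'rV[rat]_d)) : set (Rd * Rd) :=
  box (map_mx ratr p.1.1) (map_mx ratr p.1.2) `*`
  box (map_mx ratr p.2.1) (map_mx ratr p.2.2).
have -> : U = \bigcup_(p in [set p | B p `<=` U]) B p.
  apply/seteqP; split => [[x y] xyU|z [p pU /pU]//].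
  have /nbhs_ballP[e /= e0 eU] : nbhs (x, y) U by exact: open_nbhs_nbhs.
  have [a [b [xab abx]]] := nbhs_rat_box x e0.
  have [a' [b' [yab aby]]] := nbhs_rat_box y e0.
  exists ((a, b), (a', b')) => //=.
  by move=> [x' y'] [/= /abx ? /aby ?]; apply: eU.
rewrite bigcup_mkcond; apply: countable_bigcupT_measurable => [|p].
  exact: countableP.
by case: ifP => // _; apply: measurableX; exact: measurable_box.
Qed.

Lemma continuous_prod_measurable (f : V * V -> R) : continuous f ->
  measurable_fun setT (f : Rd * Rd -> R).
Proof.
move=> /continuousP cf; apply: (measurability _ (RGenOpens.measurableE R)).
move=> _ [_ [a [b ->] <-]]; rewrite setTI; apply: open_prod_measurable.
exact/cf/interval_open.
Qed.

Lemma continuous_Rd_measurable (f : V -> R) : continuous f ->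
  measurable_fun setT (f : Rd -> R).
Proof.
move=> cf; apply: (@measurable_section1 _ Rd R (fun x _ => f x) 0).
apply: (@continuous_prod_measurable (fun p => f p.1)) => p.
by apply: continuous_comp; [exact: cvg_fst|exact: cf].
Qed.

Lemma open_Rd_measurable (U : set V) : open U -> measurable (U : set Rd).
Proof.
move=> oU; have := @open_prod_measurable (fst @^-1` U).
move=> /(_ _)/wrap[].
  by apply: open_comp => // p _; exact: cvg_fst.
by move=> /(measurable_ysection (0 : Rd)); rewrite /ysection /= set_mem_set.
Qed.

Lemma compact_Rd_measurable (D : set V) : compact D -> measurable (D : set Rd).
Proof.
move=> /compact_closed cD; rewrite -[D]setCK; apply: measurableC.
by apply: open_Rd_measurable; apply: closed_openC; apply: cD; exact: norm_hausdorff.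
Qed.

Lemma sqr_coord_le (v : V) i : v ord0 i ^+ 2 <= sqnorm v.
Proof.
rewrite /sqnorm /dotp (bigD1 i)//= expr2 lerDl sumr_ge0// => j _.
by rewrite -expr2 sqr_ge0.
Qed.

Lemma sqnorm_ge0 (v : V) : 0 <= sqnorm v.
Proof. by rewrite sumr_ge0// => j _; rewrite -expr2 sqr_ge0. Qed.

Lemma continuous_sqnorm : continuous (@sqnorm R d).
Proof.
rewrite /sqnorm /dotp; apply: continuous_big => [|i _]; first exact: add_continuous.
by move=> v; apply: continuousM; exact: coord_continuous.
Qed.

Lemma compact_sqnorm_le (D : set V) : compact D ->
  exists M, 0 <= M /\ forall x, D x -> sqnorm x <= M.
Proof.
move=> cD.
have : compact (@sqnorm R d @` D).
  by apply: continuous_compact => //; apply: continuous_subspaceT; exact: continuous_sqnorm.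
move=> /compact_bounded [M [_ MD]]; exists (`|M| + 1); split; first by rewrite addr_ge0.
move=> x Dx; apply: (le_trans (ler_norm _)); apply: (MD (`|M| + 1)).
  by rewrite ltr_pwDr// ler_norm.
by exists x.
Qed.

Variable mu : {measure set Rd -> \bar R}.
Hypothesis hmu : is_lebesgue mu.

Lemma cube_fin (x : V) (s : R) : 0 <= s ->
  mu (box (\row_i (x ord0 i - s)) (\row_i (x ord0 i + s)) : set Rd) = ((s + s) ^+ d)%:E.
Proof.
move=> s0; rewrite hmu; last by move=> i; rewrite !mxE; lra.
congr (_%:E); rewrite (eq_bigr (fun=> s + s)); last by move=> i _; rewrite !mxE; ring.
by rewrite prodr_const card_ord.
Qed.

(** For [s >= 1] one has [s <= s ^+ 2], so a squared coordinate below [s] forces the coordinate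
    below [s]. Square roots are avoided at the cost of a larger cube. *)
Lemma sqnorm_lt_cube (x v : V) (s : R) : 1 <= s -> sqnorm (v - x) < s ->
  box (\row_i (x ord0 i - s)) (\row_i (x ord0 i + s)) v.
Proof.
move=> s1 vs i; have := le_lt_trans (sqr_coord_le (v - x) i) vs.
by rewrite !mxE => h; apply/andP; split; nra.
Qed.

Lemma lebesgue_sigma_finite : sigma_finite setT mu.
Proof.
exists (fun n => box (\row_i ((0 : V) ord0 i - n.+1%:R)) (\row_i ((0 : V) ord0 i + n.+1%:R))).
  apply/seteqP; split => // v _.
  exists (Num.truncn (sqnorm v)) => //; apply: sqnorm_lt_cube.
    by rewrite ler1n.
  by rewrite subr0 truncnS_gt.
by move=> n; split; [exact: measurable_box|rewrite cube_fin// ltry].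
Qed.

Lemma compact_lebesgue_fin (D : set V) : compact D -> (mu (D : set Rd) < +oo)%E.
Proof.
move=> cD; have [M [M0 DM]] := compact_sqnorm_le cD.
apply: (@le_lt_trans _ _ (mu (box (\row_i ((0 : V) ord0 i - (M + 1)))
    (\row_i ((0 : V) ord0 i + (M + 1))) : set Rd))).
  apply: le_measure; rewrite ?inE.
  - exact: compact_Rd_measurable.
  - exact: measurable_box.
  move=> x Dx; apply: sqnorm_lt_cube; first by lra.
  by rewrite subr0 (le_lt_trans (DM x Dx))// ltrDl.
by rewrite cube_fin ?ltry//; lra.
Qed.

End EuclideanMeasure.

(** * The dissipative flow and Gaussian moments *)

Section FlowAndGaussian.
Context (R : realType) (d : nat).
Local Notation V := ('rV[R]_d).
Local Notation Rd := (Rd R d).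

Lemma sqnorm_subC (u v : V) : sqnorm (u - v) = sqnorm (v - u).
Proof. by apply: eq_bigr => i _; rewrite !mxE; ring. Qed.

Lemma is_derive_sqnorm (y : R -> V) (t : R) (v : V) : is_derive t 1 y v ->
  is_derive t 1 (fun s => sqnorm (y s)) (2 * dotp v (y t)).
Proof.
move=> yv; have dy : derivable y t 1 by exact: ex_derive.
have yi i : is_derive t 1 (fun s => y s ord0 i) (v ord0 i).
  apply: DeriveDef; first by move/derivable_mxP : dy; exact.
  by have := derive_mx dy; rewrite derive_val => ->; rewrite mxE.
have := @is_derive_sum _ _ _ _ (fun i s => y s ord0 i * y s ord0 i) t 1
  (fun i => y t ord0 i * v ord0 i + y t ord0 i * v ord0 i) (fun i => is_deriveM (yi i) (yi i)).
rewrite (_ : \sum_(i < d) (fun s => y s ord0 i * y s ord0 i) = fun s => sqnorm (y s)).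
  rewrite (_ : \sum_(i < d) _ = 2 * dotp v (y t))//.
  by rewrite /dotp mulr_sumr; apply: eq_bigr => i _; ring.
by apply/funext => s; rewrite fct_sumE.
Qed.

(** Gronwall: dissipativity makes [expR (2 * c2 * t) * (sqnorm (y t) - c1 / c2)] nonincreasing. The
    absolute value of [c1] covers both signs. *)
Lemma flow_sqnorm_le (b : V -> V) (c1 c2 : R) (y : R -> V) :
  0 < c2 -> (forall x, dotp (b x) x <= c1 - c2 * sqnorm x) ->
  {within `[0, +oo[%classic, continuous y} ->
  (forall t : R, 0 < t -> is_derive t 1 y (b (y t))) ->
  sqnorm (y 1) <= expR (- (2 * c2)) * sqnorm (y 0) + `|c1| / c2.
Proof.
move=> c20 diss cy dy.
pose E t := expR (2 * c2 * t).
pose F t := sqnorm (y t) - c1 / c2.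
have dE (t : R) : is_derive t 1 E (2 * c2 * E t).
  have h := is_deriveZ (2 * c2) (is_derive_id t (1 : R)).
  rewrite [X in is_derive _ _ _ X](_ : _ = expR (2 * c2 * t) * ((2 * c2) *: 1)).
    exact: (is_derive1_comp (is_derive_expR (2 * c2 * t)) h).
  by rewrite mulrC [_ *: _]mulr1.
have dF (t : R) : (0 < t) -> is_derive t 1 F (2 * dotp (b (y t)) (y t)).
  move=> /dy/is_derive_sqnorm h; rewrite -[X in is_derive _ _ _ X]subr0.
  exact: is_deriveB.
have dEF (t : R) : 0 < t -> is_derive t 1 (E * F) (E t * (2 * dotp (b (y t)) (y t)) + F t * (2 * c2 * E t)).
  by move=> t0; exact: (is_deriveM (dE t) (dF t t0)).
have c01 : {within `[0, 1], continuous (E * F)}.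
  have cy1 : {within `[0, 1], continuous y}.
    by apply: continuous_subspaceW cy => t /=; rewrite !in_itv/= andbT => /andP[].
  have cE : continuous E.
    move=> t; apply/differentiable_continuous/derivable1_diffP.
    by apply: ex_derive; exact: dE.
  move=> t; apply: continuousM; first exact: (continuous_subspaceT cE).
  apply: continuousB; last exact: cst_continuous.
  by apply: continuous_comp; [exact: cy1|exact: continuous_sqnorm].
have : (E * F) 1 <= (E * F) 0.
  apply: (@ler0_derive1_le_cc R (E * F) 0 1) => //.
  - by move=> t; rewrite in_itv/= => /andP[t0 _]; have [] := dEF t t0.
  - move=> t; rewrite in_itv/= => /andP[t0 _]; rewrite derive1E; have [_ ->] := dEF t t0.
    have -> : E t * (2 * dotp (b (y t)) (y t)) + F t * (2 * c2 * E t) =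
       2 * E t * (dotp (b (y t)) (y t) - (c1 - c2 * sqnorm (y t))).
      by rewrite /F; field; rewrite gt_eqF.
    by rewrite mulr_ge0_le0 ?subr_le0// mulr_ge0// expR_ge0.
  - by rewrite in_itv/= lexx ler01.
  - by rewrite in_itv/= lexx ler01.
rewrite /E /F !fctE mulr0 expR0 mul1r mulr1 => h.
rewrite -(ler_pM2l (expR_gt0 (2 * c2))) mulrDr mulrA -expRD subrr expR0 mul1r.
have e1 : 1 <= expR (2 * c2) by apply: le_trans (expR_ge1Dx _); lra.
have cc : c1 / c2 <= `|c1| / c2 by rewrite ler_wpM2r ?ler_norm// invr_ge0 ltW.
have : (expR (2 * c2) - 1) * (c1 / c2) <= (expR (2 * c2) - 1) * (`|c1| / c2).
  by rewrite ler_wpM2l// subr_ge0.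
have : 0 <= `|c1| / c2 by rewrite divr_ge0// ltW.
lra.
Qed.

Lemma pow_le_expR (m : nat) (x : R) : 0 <= x -> x ^+ m.+1 <= m.+1`!%:R * expR x.
Proof.
move=> x0; rewrite mulrC -ler_pdivrMr ?ltr0n ?fact_gt0//.
by apply: le_trans (expR_ge1Dxn m x0); rewrite lerDr.
Qed.

Variable mu : {measure set Rd -> \bar R}.
Hypothesis hmu : is_lebesgue mu.

Lemma continuous_sqnormB (z : V) : continuous (fun y : V => sqnorm (z - y)).
Proof.
have cB : continuous (fun y : V => z - y).
  by move=> y; apply: continuousB; [exact: cst_continuous|exact: cvg_id].
by move=> y; exact: (@continuous_comp V V R _ (@sqnorm R d) y (cB y) (@continuous_sqnorm R d _)).
Qed.

(** Cut space into shells where [sqnorm (z - y)] lies between [n] and [n + 1]. Each sits in a cube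
    around [z], whose volume does not depend on [z], hence the uniform bound. *)
Lemma gauss_moment_bound (l : R) : 0 < l -> exists G : R, 0 <= G /\ forall z : V,
  (\int[mu]_y (sqnorm (z - y) * expR (- l * sqnorm (z - y)))%:E <= G%:E)%E.
Proof.
move=> l0.
pose a n : R := n.+1%:R * expR (- l * n%:R) * (n.+1%:R + n.+1%:R) ^+ d.
pose rr := expR (- l / 2).
have rr0 : 0 <= rr by exact: expR_ge0.
have rr1 : rr < 1 by rewrite expR_lt1; lra.
(* Half of the exponential decay absorbs the polynomial factor of degree [d + 1]; the other half is
   the geometric ratio [rr]. *)
have [K [K0 aK]] : exists K, 0 <= K /\ forall n, a n <= K * rr ^+ n.
  pose B := (2 / l) ^+ d.+1 * d.+1`!%:R * expR (l / 2) * 2 ^+ d.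
  exists B; split; first by rewrite !mulr_ge0 ?exprn_ge0 ?expR_ge0// divr_ge0// ltW.
  move=> n.
  have := @pow_le_expR d (l / 2 * n.+1%:R) _; rewrite exprMn => /(_ _)/wrap[].
    by rewrite mulr_ge0// divr_ge0// ltW.
  have l2 : 0 <= (2 / l) ^+ d.+1 by rewrite exprn_ge0// divr_ge0// ltW.
  move=> /(ler_wpM2l l2); rewrite mulrA -exprMn (_ : 2 / l * (l / 2) = 1); last first.
    by field; rewrite gt_eqF.
  rewrite expr1n mul1r => H.
  have e0 : 0 <= expR (- l * n%:R) * 2 ^+ d by rewrite mulr_ge0 ?expR_ge0 ?exprn_ge0.
  have := ler_wpM2l e0 H.
  have -> : expR (- l * n%:R) * 2 ^+ d * n.+1%:R ^+ d.+1 = a n.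
    rewrite /a (_ : n.+1%:R + n.+1%:R = 2 * n.+1%:R :> R); last by ring.
    by rewrite exprMn exprS; ring.
  move=> /le_trans; apply; rewrite /B /rr -expRM_natl.
  have -> : expR (- l * n%:R) * 2 ^+ d * ((2 / l) ^+ d.+1 * (d.+1`!%:R * expR (l / 2 * n.+1%:R)))
     = (2 / l) ^+ d.+1 * d.+1`!%:R * 2 ^+ d * (expR (- l * n%:R) * expR (l / 2 * n.+1%:R)) by ring.
  rewrite -expRD [leRHS](_ : _ = (2 / l) ^+ d.+1 * d.+1`!%:R * 2 ^+ d *
     (expR (l / 2) * expR (n%:R * (- l / 2)))); last by ring.
  rewrite -expRD (_ : - l * n%:R + l / 2 * n.+1%:R = l / 2 + n%:R * (- l / 2))//.
  by rewrite -[n.+1]addn1 natrD; field.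
exists (K / (1 - rr)); split; first by rewrite divr_ge0// subr_ge0 ltW.
move=> z.
pose Bx n : set Rd := box (\row_i (z ord0 i - n.+1%:R)) (\row_i (z ord0 i + n.+1%:R)).
have mBx n : measurable (Bx n) by exact: measurable_box.
have mI n : measurable_fun setT (\1_(Bx n) : Rd -> R) by exact: measurable_indic.
pose F (n : nat) (y : Rd) : \bar R := (n.+1%:R * expR (- l * n%:R) * \1_(Bx n) y)%:E.
have F0 n y : (0 <= F n y)%E by rewrite lee_fin mulr_ge0 ?indicE// mulr_ge0// expR_ge0.
have mF n : measurable_fun setT (F n).
  by apply/measurable_EFinP; apply: (@measurable_funM _ _ _ _ (cst _) (\1_(Bx n))).
have msq : measurable_fun setT ((fun y => sqnorm (z - y)) : Rd -> R).
  exact: (continuous_Rd_measurable (@continuous_sqnormB z)).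
apply: (@le_trans _ _ (\int[mu]_y (\sum_(n <oo) F n y))%E).
  apply: ge0_le_integral => //.
  - by move=> y _; rewrite lee_fin mulr_ge0 ?expR_ge0 ?sqnorm_ge0.
  - apply/measurable_EFinP/measurable_funM => //.
    by apply: measurableT_comp => //; exact: measurable_funM.
  - by apply: ge0_emeasurable_sum.
  move=> y _; set s := sqnorm (z - y); pose n := Num.truncn s.
  have s0 : 0 <= s by exact: sqnorm_ge0.
  have /andP[ns sn] := truncn_itv s0.
  apply: (@le_trans _ _ (F n y)).
    rewrite lee_fin indicE mem_set ?mulr1; last first.
      apply: sqnorm_lt_cube; first by rewrite ler1n.
      by rewrite sqnorm_subC.
    rewrite ler_pM ?expR_ge0//; first exact: ltW.
    by rewrite ler_expR !mulNr lerN2 ler_wpM2l// ltW.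
  have := @nneseries_lim_ge R (F^~ y) xpredT 0 n.+1 (fun _ _ _ => F0 _ _).
  apply: le_trans; rewrite big_nat_recr//= leeDr//.
  by apply: sume_ge0.
rewrite integral_nneseries//.
have FE n : (\int[mu]_y F n y = (a n)%:E)%E.
  have I0 y : 0 <= \1_(Bx n) y :> R by rewrite indicE.
  have e0 : 0 <= n.+1%:R * expR (- l * n%:R) by rewrite mulr_ge0// expR_ge0.
  rewrite /F (ge0_integralZl_EFin mu measurableT (mI n) I0 e0).
  by rewrite integral_indic// setIT cube_fin.
under eq_eseriesr do rewrite FE.
have a0 n : 0 <= a n.
  by apply: mulr_ge0; rewrite ?exprn_ge0 ?addr_ge0// mulr_ge0// expR_ge0.
apply: lime_le; first by apply: is_cvg_nneseries => n _ _; rewrite lee_fin.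
apply: nearW => n; rewrite sumEFin lee_fin.
apply: (@le_trans _ _ (series (geometric K rr) n)).
  by rewrite /series /=; apply: ler_sum => i _; exact: aK.
rewrite geometric_seriesE ?lt_eqF//= ler_wpM2r//; first by rewrite invr_ge0 subr_ge0 ltW.
by rewrite ler_piMr// lerBlDr lerDl exprn_ge0.
Qed.

End FlowAndGaussian.

(** * Lyapunov and minorization conditions *)

(** The structure is put on [mu] itself, so an arbitrary measure can be replaced by [subst] with one
    that supports Tonelli. *)
Lemma sigma_finite_measure_of d (T : measurableType d) (R : realType)
    (mu : {measure set T -> \bar R}) : sigma_finite setT mu ->
  exists m : {sigma_finite_measure set T -> \bar R}, (m : {measure set T -> \bar R}) = mu.
Proof.
case: mu => m c sf.
pose F := Measure_isSigmaFinite.Build _ _ _ (Measure.Pack c) sf.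
by exists (HB.pack_for {sigma_finite_measure set T -> \bar R} (Measure.sort (Measure.Pack c)) F).
Qed.

Section GaussianKernel.
Context (R : realType) (d : nat).
Local Notation V := ('rV[R]_d).
Local Notation Rd := (Rd R d).
Variable mu : {measure set Rd -> \bar R}.
Hypothesis hmu : is_lebesgue mu.
Variables (k : V -> V -> R) (th : V -> V).
Hypothesis mk : forall x, measurable_fun setT (k x : Rd -> R).
Hypothesis k1 : forall x, (\int[mu]_y (k x y)%:E = 1)%E.

(** Young's inequality by completing the square: the coefficient of [sqnorm x] may be as close to 1
    as desired, and the price falls on the Gaussian tail. *)
Lemma sqnorm_split (c : R) (x y : V) : 1 < c ->
  sqnorm y <= c * sqnorm x + (1 + (c - 1)^-1) * sqnorm (x - y).
Proof.
move=> c1; rewrite /sqnorm /dotp !mulr_sumr -big_split /=.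
apply: ler_sum => i _; rewrite !mxE; move: (x ord0 i) (y ord0 i) => a b.
have c0 : 0 < c - 1 by rewrite subr_gt0.
rewrite -subr_ge0.
rewrite [leRHS](_ : _ = (c - 1)^-1 * ((c - 1) * a + (a - b)) ^+ 2).
  by rewrite mulr_ge0 ?sqr_ge0// invr_ge0 ltW.
by field; rewrite gt_eqF.
Qed.

(* [k x] has mass one and Gaussian tails around [th x], so its second moment is
   at most [(1 + eps) |th x|^2] plus a constant, for any [eps > 0]. *)
Lemma kernel_lyapunov (C0 l0 c2 c : R) : 0 < l0 -> 0 < c2 -> 0 <= C0 -> 0 <= c ->
  (forall x, sqnorm (th x) <= expR (- (2 * c2)) * sqnorm x + c) ->
  (forall x y, 0 <= k x y <= C0 * expR (- l0 * sqnorm (th x - y))) ->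
  exists K : R, 1 <= K /\ forall x,
    (\int[mu]_y (sqnorm y * k x y)%:E <= (expR (- c2) * sqnorm x + K)%:E)%E.
Proof.
move=> l00 c20 C00 c0 hth hk.
have [G [G0 hG]] := gauss_moment_bound hmu l00.
(* Half of the contraction [expR (- (2 * c2))] of the flow is spent on this factor, which leaves the
   rate [expR (- c2)], still below 1. *)
pose E1 := expR c2; have E11 : 1 < E1 by rewrite expR_gt1.
have E10 : 0 <= E1 by exact: expR_ge0.
pose E2 := 1 + (E1 - 1)^-1.
have E20 : 0 <= E2 by rewrite addr_ge0// invr_ge0 subr_ge0 ltW.
exists (1 + (E1 * c + E2 * C0 * G)); split.
  by rewrite lerDl addr_ge0// mulr_ge0// mulr_ge0.
move=> x; pose g (y : Rd) := sqnorm (th x - y) * expR (- l0 * sqnorm (th x - y)).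
have msq : measurable_fun setT ((fun y => sqnorm (th x - y)) : Rd -> R).
  exact: (continuous_Rd_measurable (@continuous_sqnormB R d (th x))).
have mg : measurable_fun setT g.
  by apply: measurable_funM => //; apply: measurableT_comp => //; exact: measurable_funM.
have g0 y : 0 <= g y by rewrite mulr_ge0 ?sqnorm_ge0 ?expR_ge0.
have ms : measurable_fun setT (@sqnorm R d : Rd -> R).
  exact: (continuous_Rd_measurable (@continuous_sqnorm R d)).
have k0 y : 0 <= k x y by have /andP[] := hk x y.
have E1s : 0 <= E1 * sqnorm (th x) by rewrite mulr_ge0// sqnorm_ge0.
have EC : 0 <= E2 * C0 by rewrite mulr_ge0.
apply: (@le_trans _ _ (\int[mu]_y (E1 * sqnorm (th x) * k x y + E2 * C0 * g y)%:E)%E).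
  apply: ge0_le_integral_EFin => //.
  - exact: measurable_funM.
  - by apply: measurable_funD; exact: measurable_funM.
  - by move=> y; rewrite mulr_ge0// sqnorm_ge0.
  move=> y; apply: (@le_trans _ _ ((E1 * sqnorm (th x) + E2 * sqnorm (th x - y)) * k x y)).
    by rewrite ler_wpM2r// sqnorm_split.
  rewrite mulrDl lerD2l /g.
  have /andP[_ hkC] := hk x y.
  have := ler_wpM2l (mulr_ge0 E20 (sqnorm_ge0 (th x - y))) hkC.
  by move=> /le_trans; apply; rewrite le_eqVlt; apply/orP; left; apply/eqP; ring.
rewrite ge0_integralD_EFin//; last 4 first.
- exact: measurable_funM.
- exact: measurable_funM.
- by move=> y; rewrite mulr_ge0.
- by move=> y; rewrite mulr_ge0.
rewrite (ge0_integralZl_EFin mu measurableT (mk x) k0 E1s) k1 mule1.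
rewrite (ge0_integralZl_EFin mu measurableT mg g0 EC).
apply: (@le_trans _ _ ((E1 * sqnorm (th x))%:E + (E2 * C0)%:E * G%:E)%E).
  by rewrite leeD2l// lee_wpmul2l ?lee_fin//; exact: hG.
rewrite -EFinM -EFinD lee_fin.
have h1 : E1 * sqnorm (th x) <= expR (- c2) * sqnorm x + E1 * c.
  apply: (le_trans (ler_wpM2l E10 (hth x))); rewrite mulrDr lerD2r mulrA -expRD.
  by rewrite (_ : c2 + - (2 * c2) = - c2)//; ring.
move: h1; move: (E1 * _) (E2 * C0 * G) (E1 * c) (expR _ * _) => p1 p2 p3 p4 h1.
by apply: (le_trans (lerD h1 (lexx _))); lra.
Qed.

(** The minorant is a constant times the indicator of the unit cube: the cube has volume 1, so the
    constant is also its mass. *)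
Lemma kernel_minorization (C0 l0 c2 c : R) : 0 < l0 -> 1 <= C0 -> 0 <= c ->
  (forall x, sqnorm (th x) <= c2 * sqnorm x + c) -> 0 <= c2 ->
  (forall x y, C0^-1 * expR (- sqnorm (th x - y) / l0) <= k x y) ->
  forall r, exists (a : R) (h : Rd -> R), [/\ 0 < a <= 1, measurable_fun setT h,
     (forall y, 0 <= h y), (\int[mu]_y (h y)%:E = a%:E)%E &
     forall x y, sqnorm x <= r -> h y <= k x y].
Proof.
move=> l00 C01 c0 hth c20 hk r.
have C00 : 0 < C0 by lra.
(* [S] bounds [sqnorm (th x - y)] for [sqnorm x <= r] and [y] in the unit cube, where
   [sqnorm y <= d]. The absolute value keeps [S] nonnegative for negative [r], hence [a <= 1]. *)
pose S := 2 * (c2 * `|r| + c) + 2 * d%:R.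
have S0 : 0 <= S by rewrite addr_ge0// mulr_ge0// addr_ge0// mulr_ge0.
pose a := C0^-1 * expR (- S / l0).
have a0 : 0 < a by rewrite mulr_gt0 ?invr_gt0// expR_gt0.
have a1 : a <= 1.
  rewrite mulr_ile1 ?expR_ge0 ?invr_ge0 ?(ltW C00)//; first by rewrite invf_le1.
  by rewrite expR_le1 mulNr oppr_le0 divr_ge0// ltW.
pose U : set Rd := box (0 : V) (const_mx 1).
have mU : measurable U by exact: measurable_box.
have mI : measurable_fun setT (\1_U : Rd -> R) by exact: measurable_indic.
have I0 y : 0 <= \1_U y :> R by rewrite indicE.
have muU : mu U = 1%E.
  rewrite /U hmu; last by move=> i; rewrite !mxE.
  by congr (_%:E); rewrite big1// => i _; rewrite !mxE subr0.
exists a, (fun y => a * \1_U y); split.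
- by rewrite a0.
- exact: measurable_funM.
- by move=> y; rewrite mulr_ge0// ltW.
- rewrite (ge0_integralZl_EFin mu measurableT mI I0 (ltW a0)).
  by rewrite integral_indic// setIT muU mule1.
move=> x y xr; have k0 : 0 <= k x y.
  by apply: le_trans (hk x y); rewrite mulr_ge0 ?expR_ge0// invr_ge0 ltW.
rewrite indicE; case: (boolP (y \in U)) => [/set_mem yU|_]; last by rewrite mulr0.
rewrite mulr1; apply: le_trans (hk x y).
rewrite ler_wpM2l ?invr_ge0 ?(ltW C00)// ler_expR ler_wpM2r ?invr_ge0 ?(ltW l00)//.
rewrite lerN2.
have sy : sqnorm y <= d%:R.
  rewrite /sqnorm /dotp -[leRHS](_ : \sum_(i < d) (1 : R) = _); last first.
    by rewrite sumr_const card_ord.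
  apply: ler_sum => i _; have := yU i; rewrite !mxE => /andP[y0 y1].
  by apply: mulr_ile1; exact: ltW.
have st : sqnorm (th x) <= c2 * `|r| + c.
  apply: (le_trans (hth x)); rewrite lerD2r ler_wpM2l//.
  by rewrite (le_trans xr)// ler_norm.
apply: (@le_trans _ _ (2 * sqnorm (th x) + 2 * sqnorm y)).
  rewrite /sqnorm /dotp !mulr_sumr -big_split /=; apply: ler_sum => i _.
  rewrite !mxE -subr_ge0 [leRHS](_ : _ = (th x ord0 i + y ord0 i) ^+ 2) ?sqr_ge0//.
  by ring.
by rewrite /S lerD// ler_wpM2l.
Qed.

End GaussianKernel.

(** * Equivalence of the polynomial weight with the Harris weight *)

Section WeightedSpaceRd.
Context (R : realType) (d : nat).
Local Notation Rd := (Rd R d).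
Variable mu : {sigma_finite_measure set Rd -> \bar R}.
Variable beta : R.
Hypothesis beta01 : 0 < beta <= 1.

Definition lyap_weight (x : Rd) : R := 1 + beta * sqnorm (x : 'rV[R]_d).

Lemma rho2E (x : 'rV[R]_d) : rho 2 x = 1 + sqnorm x.
Proof. by rewrite /rho divff ?powRr1// addr_ge0// sqnorm_ge0. Qed.

Lemma lyap_weight_ge1 x : 1 <= lyap_weight x.
Proof.
by have /andP[b0 _] := beta01; rewrite lerDl mulr_ge0 ?sqnorm_ge0// ltW.
Qed.

Lemma measurable_sqnorm : measurable_fun setT (@sqnorm R d : Rd -> R).
Proof. exact: (continuous_Rd_measurable (@continuous_sqnorm R d)). Qed.

Lemma measurable_lyap_weight : measurable_fun setT lyap_weight.
Proof.
by apply: measurable_funD => //; apply: measurable_funM => //; exact: measurable_sqnorm.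
Qed.

(** For [0 < beta <= 1] the weight [rho 2] lies between [lyap_weight] and [beta^-1 * lyap_weight],
    so the space does not depend on the [beta] that Harris' argument produces. *)
Lemma in_L1wP (f : Rd -> R) : in_L1w mu 2 f <-> inW mu lyap_weight f.
Proof.
have /andP[b0 b1] := beta01.
have m2 : measurable_fun setT ((fun x => 1 + sqnorm x) : Rd -> R).
  by apply: measurable_funD => //; exact: measurable_sqnorm.
split=> -[mf ff]; split => //.
  apply: le_lt_trans ff; apply: ge0_le_integral_EFin => //.
  - exact: (measurable_wnorm_integrand measurable_lyap_weight).
  - apply: (eq_measurable_fun (fun x : Rd => (1 + sqnorm x) * `|f x|)).
      by move=> x _; rewrite rho2E.
    by apply: measurable_funM => //; exact: measurableT_comp.
  - by move=> x; rewrite mulr_ge0// (le_trans ler01)// lyap_weight_ge1.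
  - by move=> x; rewrite ler_wpM2r// rho2E lerD2l ler_piMl// sqnorm_ge0.
apply: (@le_lt_trans _ _ (\int[mu]_x (beta^-1 * (lyap_weight x * `|f x|))%:E)%E).
  apply: ge0_le_integral_EFin => //.
  - apply: (eq_measurable_fun (fun x : Rd => (1 + sqnorm x) * `|f x|)).
      by move=> x _; rewrite rho2E.
    by apply: measurable_funM => //; exact: measurableT_comp.
  - apply: measurable_funM => //.
    exact: (measurable_wnorm_integrand measurable_lyap_weight).
  - by move=> x; rewrite mulr_ge0// rho2E addr_ge0// sqnorm_ge0.
  - move=> x; rewrite mulrA ler_wpM2r// rho2E mulrDr mulr1 mulrA mulVf ?gt_eqF// mul1r.
    by rewrite lerD2r invf_ge1.
rewrite ge0_integralZl_EFin//; last 3 first.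
- exact: (measurable_wnorm_integrand measurable_lyap_weight).
- by move=> x; rewrite mulr_ge0// (le_trans ler01)// lyap_weight_ge1.
- by rewrite invr_ge0 ltW.
by rewrite lte_mul_pinfty// ?lee_fin ?invr_ge0 ?ltW.
Qed.

Lemma in_BP (D : set 'rV[R]_d) (f : Rd -> R) :
  in_B mu D f <-> inW mu lyap_weight f /\ inQ mu (D : set Rd) f.
Proof.
split=> [[/in_L1wP fW fQ]|[fW [_ fQ]]]; first by do 2 split => //; case: fW.
by split => //; apply/in_L1wP.
Qed.

Lemma in_VBP (D : set 'rV[R]_d) (f : Rd -> R) :
  in_VB mu D f <-> inW0 mu lyap_weight f /\ inQ mu (D : set Rd) f.
Proof.
split=> [[/in_BP[fW fQ] f0]|[[fW f0] fQ]]; first by [].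
by split => //; apply/in_BP.
Qed.

End WeightedSpaceRd.

Theorem theorem4p7
  (R : realType) (d : nat) (b : 'rV[R]_d -> 'rV[R]_d)
  (* (A) local Lipschitz continuity *)
  (hbLip : forall x0 : 'rV[R]_d, exists K delta0 : R, 0 < K /\ 0 < delta0 /\
     forall x, enorm (x0 - x) < delta0 -> enorm (b x0 - b x) <= K * enorm (x0 - x))
  (* (B) dissipativity *)
  (c1 c2 : R) (hc2 : 0 < c2)
  (hdiss : forall x, dotp (b x) x <= c1 - c2 * sqnorm x)
  (* theta = flow of  d theta / dt = b(theta)  (forward in time) *)
  (theta : R -> 'rV[R]_d -> 'rV[R]_d)
  (htheta0 : forall x, theta 0 x = x)
  (hthetac : forall x, {within `[0, +oo[%classic, continuous (fun t => theta t x)})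
  (hthetad : forall (x : 'rV[R]_d) (t : R), 0 < t -> is_derive t 1 (fun s => theta s x) (b (theta t x)))
  (* Lebesgue measure on R^d *)
  (mu : {measure set (Rd R d) -> \bar R}) (hmu : is_lebesgue mu)
  (* a standard Brownian motion W in R^d on a probability space *)
  (dT : measure_display) (T : measurableType dT) (P : probability T R)
  (W : R -> T -> 'rV[R]_d)
  (hW0 : forall w, W 0 w = 0)
  (hWc : forall w, {within `[0, +oo[%classic, continuous (fun t => W t w)})
  (hWm : forall t, measurable_fun setT (W t : T -> Rd R d))
  (hWlaw : forall (n : nat) (t : nat -> R) (A : nat -> set (Rd R d)),
     t 0%N = 0 -> (forall k, t k < t k.+1) -> (forall k, measurable (A k)) ->
     P [set w | forall k, (k < n)%N -> A k (W (t k.+1) w - W (t k) w)] =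
     (\prod_(k < n) Rintegral mu (A k) (gauss (t k.+1 - t k)))%:E)
  (* X^x_t : the solution of dX = b(X) dt + dW, X_0 = x, on [0,1] *)
  (X : 'rV[R]_d -> R -> T -> 'rV[R]_d)
  (hXc : forall x w, {within `[0, 1]%classic, continuous (fun t => X x t w)})
  (hXeq : forall (x : 'rV[R]_d) (w : T) (t : R), 0 <= t <= 1 ->
     X x t w = x + \row_i Rintegral lebesgue_measure `[0, t]%classic
                      (fun s => b (X x s w) ord0 i) + W t w)
  (hXm : forall x, measurable_fun setT (X x 1 : T -> Rd R d))
  (* kappa(x, .) is the density of the law of X^x_1 *)
  (kappa : 'rV[R]_d -> 'rV[R]_d -> R)
  (hlaw : forall x (A : set (Rd R d)), measurable A ->
     P [set w | A (X x 1 w)] = (\int[mu]_(y in A) (kappa x y)%:E)%E)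
  (* known properties of kappa *)
  (hkc : continuous (fun p : 'rV[R]_d * 'rV[R]_d => kappa p.1 p.2))
  (l0 l1 C0 C1 : R) (hl0 : 0 < l0 <= 1) (hl1 : 0 < l1 <= 1)
  (hC0 : 1 <= C0) (hC1 : 1 <= C1)
  (hkb : forall x y,
     C0^-1 * expR (- sqnorm (theta 1 x - y) / l0) <= kappa x y
     /\ kappa x y <= C0 * expR (- l0 * sqnorm (theta 1 x - y)))
  (hkg : forall x y,
     differentiable (fun x' => kappa x' y) x /\ differentiable (kappa x) y /\
     enorm (grad (fun x' => kappa x' y) x) <= C1 * expR (- l1 * sqnorm (theta 1 x - y)) /\
     enorm (grad (kappa x) y) <= C1 * expR (- l1 * sqnorm (theta 1 x - y)))
  (* the compact neighbourhood D of 0 *)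
  (D : set 'rV[R]_d) (hDc : compact D) (hD0 : nbhs (0 : 'rV[R]_d) D)
  (* perturbations kappa_delta = kappa + delta kdot + r_delta *)
  (delta_bar : R) (hdb : 0 < delta_bar)
  (kdot : Rd R d -> Rd R d -> R) (hkdot : in_L2DD mu D kdot)
  (r : R -> Rd R d -> Rd R d -> R)
  (hr : forall delta, 0 <= delta < delta_bar -> in_L2DD mu D (r delta))
  (hr0 : r 0 = (fun _ _ => 0))
  (hro : (fun delta => L2norm mu (r delta) / delta) @ 0^'+ --> 0)
  (* every L_delta, delta in [0, delta_bar), is integral preserving *)
  (hpres : forall delta, 0 <= delta < delta_bar -> forall g : Rd R d -> R, in_L1 mu g ->
     integ mu (kop mu (fun x y => kappa x y + delta * kdot x y + r delta x y) g) = integ mu g)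
  (* f0 : invariant probability density of L_0 in B *)
  (f0 : Rd R d -> R)
  (hf0 : in_B mu D f0 /\ integ mu f0 = 1%E /\ {ae mu, forall x, 0 <= f0 x} /\
         {ae mu, forall y, kop mu kappa f0 y = f0 y})
  (* f delta : invariant density of L_delta in B, for delta > 0 small *)
  (f : R -> Rd R d -> R)
  (hf : \forall delta \near 0^'+,
     in_B mu D (f delta) /\ integ mu (f delta) = 1%E /\
     {ae mu, forall y,
        kop mu (fun x y => kappa x y + delta * kdot x y + r delta x y) (f delta) y = f delta y}) :
  in_VB mu D (kop mu kdot f0) /\
  exists g : Rd R d -> R,
    (* g = (Id - L_0)^{-1} (Ldot f0), the unique solution in V_B *)
    in_VB mu D g /\
    {ae mu, forall y, g y - kop mu kappa g y = kop mu kdot f0 y} /\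
    (forall h, in_VB mu D h ->
       {ae mu, forall y, h y - kop mu kappa h y = kop mu kdot f0 y} ->
       {ae mu, forall y, h y = g y}) /\
    ((fun delta => L1norm mu (fun y => (f delta y - f0 y) / delta - g y)) @ 0^'+ --> 0%E).
Proof.
have [m mE] := sigma_finite_measure_of (lebesgue_sigma_finite hmu).
subst mu.
have /andP[l00 _] := hl0.
have C00 : 0 <= C0 by exact: le_trans hC0.
have mkap : measurable_fun setT (fun p : Rd R d * Rd R d => kappa p.1 p.2).
  exact: (continuous_prod_measurable hkc).
have kg x y : 0 <= kappa x y <= C0 * expR (- l0 * sqnorm (theta 1 x - y)).
  have [lb ->] := hkb x y; rewrite andbT; apply: le_trans lb.
  by rewrite mulr_ge0 ?expR_ge0// invr_ge0.
have kC x y : 0 <= kappa x y <= C0.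
  have /andP[-> /le_trans->]// := kg x y.
  rewrite ler_piMr// expR_le1 mulNr oppr_le0 mulr_ge0 ?sqnorm_ge0//.
  exact: ltW.
have k1 x : (\int[m]_y (kappa x y)%:E = 1)%E.
  by rewrite -(hlaw x setT measurableT) -(@probability_setT _ _ _ P).
have c0 : 0 <= `|c1| / c2 by rewrite divr_ge0// ltW.
have hth x : sqnorm (theta 1 x) <= expR (- (2 * c2)) * sqnorm x + `|c1| / c2.
  have := flow_sqnorm_le hc2 hdiss (hthetac x) (hthetad x).
  by rewrite htheta0.
have mkx x : measurable_fun setT (kappa x : Rd R d -> R).
  exact: (@measurable_section2 _ (Rd R d) R kappa x mkap).
have [K [K1 lyap]] := kernel_lyapunov hmu mkx k1 l00 hc2 C00 c0 hth kg.
have minor := kernel_minorization hmu l00 hC0 c0 hth (expR_ge0 _) (fun x y => (hkb x y).1).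
have g01 : 0 <= expR (- c2) < 1 by rewrite expR_ge0 expR_lt1 oppr_lt0.
have [beta [q [b01 q01 contr]]] := @harris_contraction _ (Rd R d) R m kappa (@sqnorm R d) _ _ _ mkap kC k1
  (@measurable_sqnorm R d) (@sqnorm_ge0 R d) g01 K1 lyap minor.
pose w := @lyap_weight R d beta.
have mw : measurable_fun setT w by exact: measurable_lyap_weight.
have w1 x : 1 <= w x by exact: (lyap_weight_ge1 b01).
have contrW g : inW0 m w g ->
    (wnorm m w (intop m kappa g) <= q%:E * wnorm m w g)%E.
  move=> [gW g0]; have [mg _] := gW; apply: contr => //.
  have [_] := (in_L1wP m b01 g).2 gW; apply: le_lt_trans.
  by apply: eq_lee; apply: eq_integral => x _; rewrite rho2E.
have mD := compact_Rd_measurable hDc.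
have finD := compact_lebesgue_fin hmu hDc.
have [M [M0 DM]] := compact_sqnorm_le hDc.
have M10 : 0 <= 1 + M by rewrite addr_ge0.
have wM x : D x -> w x <= 1 + M.
  move=> /DM sM; rewrite lerD2l; apply: le_trans sM.
  by have /andP[_ b1] := b01; rewrite ler_piMl// sqnorm_ge0.
have L2 k : in_L2DD m D k -> inL2 m (D : set (Rd R d)) k by move=> [? []].
have rL2 e : 0 <= e < delta_bar -> inL2 m (D : set (Rd R d)) (r e) by move=> /hr/L2.
have pres e : 0 <= e < delta_bar -> forall g, inW m w g ->
    (\int[m]_x (intop m (fun x y => kappa x y + e * kdot x y + r e x y) g x)%:E =
     \int[m]_x (g x)%:E)%E.
  move=> he g gW; have gL1 : in_L1 m g.
    split; first by case: gW.
    exact: le_lt_trans (L1norm_le_wnorm m mw w1 gW.1) gW.2.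
  exact: (hpres e he g gL1).
have [/(in_BP m b01)[f0W f0Q] [f01 [_ f0E]]] := hf0.
have kdL2 := L2 _ hkdot.
have Ld0 := intop_derivative_mean0 mw w1 mkap kC mD finD M10 wM hdb kdL2 rL2 hro pres
  f0W f0Q f01 f0E.
have [LdQ _] := intopL2_inQ mD kdL2 f0Q.
have pr0 := pres0 hdb hr0 pres.
have [g [g0 gE]] := resolvent_exists mw w1 mkap kC q01 pr0 contrW Ld0.
have [LgQ _] := intop_inQ mw w1 mkap kC mD finD g0.1.
(* The weighted [L1] theory says nothing about [L2(D)]; the fixed-point equation does, since [kdot]
   maps [f0] into it and [kappa] maps [g] to a bounded function. *)
have gQ : inQ m (D : set (Rd R d)) g.
  have [sQ _] := sqintD mD LdQ LgQ.
  by have -> : g = (fun y => intop m kdot f0 y + intop m kappa g y) by exact/funext.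
split; first exact/(in_VBP m b01).
exists g; split; first exact/(in_VBP m b01).
have gE' : {ae m, forall y, g y - kop m kappa g y = kop m kdot f0 y}.
  by apply: aeW => y; rewrite {1}gE addrK.
split; first exact: gE'.
split.
  move=> h /(in_VBP m b01)[h0 _] hE.
  exact: (resolvent_unique mw w1 mkap kC q01 pr0 contrW h0 g0 hE gE').
apply: (response_cvg mw w1 mkap kC q01 contrW mD finD M10 wM hdb kdL2 rL2 hr0 hro pres
  f0W f0Q f01 f0E g0 gE).
by apply: filterS hf => e [/(in_BP m b01)[fW fQ] [f1 fE]].
Qed.
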